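(* Let $(d(n))_{n\ge0}$ be Romik's integer sequence of normalised Taylor coefficients of Jacobi's theta function $\theta_3$ at $\tau=i$ (defined in the context). Let $p$ be a prime with $p\equiv 1\pmod 4$ and let $e$ be a positive integer. Then, for all $n\ge e+1$, $$d\left(n+\tfrac{p^{e-1}(p-1)}{2}\right)\equiv(-1)^{(p-5)/4}\,\bigl(3\cdot 7\cdot 11\cdots(2p-3)\bigr)^{2p^{e-1}}\,d(n)\pmod{p^e}.$$
   Context: Jacobi's theta function is $\theta_3(\tau)=\sum_{n=-\infty}^{\infty} q^{n^2}$ with $q=e^{i\pi\tau}$, for $\tau$ in the upper half plane. The numbers $d(n)$, $n\ge0$, are defined by the expansion (around $z=0$) $$\theta_3\left(i\frac{1+z}{1-z}\right)=\theta_3(i)(1-z)^{1/2}\sum_{n=0}^\infty \frac{d(n)}{(2n)!}\Phi^n z^{2n},\qquad \Phi=\frac{\Gamma^8(1/4)}{128\pi^4},\quad \theta_3(i)=\frac{\pi^{1/4}}{\Gamma(3/4)}.$$ Romik proved that the $d(n)$ are integers and that they are equivalently given by the following recursive scheme. Let $\Pi_1(N)=\prod_{j=1}^N(4j-1)^2$ and $\Pi_3(N)=\prod_{j=1}^N(4j-3)^2$. Let $u(0)=1$, $u(n)=\Pi_1(n)-\sum_{m=0}^{n-1}\binom{2n+1}{2m+1}\Pi_3(n-m)u(m)$ for $n\ge1$; $v(0)=1$, $v(n)=2^{n-1}\Pi_3(n)-\frac12\sum_{m=1}^{n-1}\binom{2n}{2m}v(m)v(n-m)$ for $n\ge1$;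 $U(t)=\sum_{n\ge0}\frac{u(n)}{(2n+1)!}t^{2n+1}$; and $r(n,k)=2^{n-k}\frac{(2n)!}{(2k)!}\langle t^{2n}\rangle U^{2k}(t)$, where $\langle t^N\rangle F(t)$ is the coefficient of $t^N$ in $F(t)$. Then $d(0)=1$ and $d(n)=v(n)-\sum_{k=0}^{n-1}r(n,k)d(k)$ for $n\ge1$. The product $3\cdot7\cdot11\cdots(2p-3)$ is $\prod_{j=1}^{(p-1)/2}(4j-1)$. *)

(* Defs.v *)
From Stdlib Require Import Reals ZArith Znumtheory List Lra Psatz.
From Coquelicot Require Import Coquelicot.

Open Scope R_scope.

Definition Cexp (z : C) : C :=
  (exp (Re z) * cos (Im z), exp (Re z) * sin (Im z)).

(* Principal branch: the square root of [z] with non-negative real part,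
   continuous off the negative real axis. *)
Definition Csqrt (z : C) : C :=
  (sqrt ((Cmod z + Re z) / 2),
   if Rle_dec 0 (Im z) then sqrt ((Cmod z - Re z) / 2)
   else - sqrt ((Cmod z - Re z) / 2)).

Lemma Csqrt_sqr (z : C) : (Csqrt z * Csqrt z)%C = z.
Proof.
destruct z as [x y].
assert (Hx := Rle_trans _ _ _ (Rmax_l _ _) (Rmax_Cmod (x, y))).
assert (Hm : Cmod (x, y) ^ 2 = x ^ 2 + y ^ 2).
{ unfold Cmod; simpl fst; simpl snd; apply pow2_sqrt; nra. }
unfold Csqrt, Cmult; simpl fst in *; simpl snd in *; unfold Re, Im; simpl.
set (m := Cmod (x, y)) in *.
assert (Hax := Rle_abs x); assert (Hax' := Rle_abs (- x)).
rewrite Rabs_Ropp in Hax'.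
assert (Ha : 0 <= (m + x) / 2) by lra.
assert (Hb : 0 <= (m - x) / 2) by lra.
assert (Hab : sqrt ((m + x) / 2) * sqrt ((m - x) / 2) = Rabs y / 2).
{ rewrite <- sqrt_mult by assumption.
  replace ((m + x) / 2 * ((m - x) / 2)) with (Rsqr (y / 2))
    by (unfold Rsqr; nra).
  rewrite sqrt_Rsqr_abs; unfold Rdiv; rewrite Rabs_mult.
  rewrite (Rabs_pos_eq (/ 2)) by lra; reflexivity. }
assert (Hsa := sqrt_sqrt _ Ha); assert (Hsb := sqrt_sqrt _ Hb).
destruct (Rle_dec 0 y) as [Hy | Hy]; apply injective_projections; simpl.
- nra.
- rewrite Rabs_pos_eq in Hab by assumption; lra.
- nra.
- rewrite Rabs_left in Hab by lra; lra.
Qed.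

Definition CSeries (a : nat -> C) : C :=
  (Series (fun n => Re (a n)), Series (fun n => Im (a n))).

(* The sum over all integers [n], split into [n >= 0] and [n < 0]; it
   converges absolutely when [Im tau > 0], the only case of interest. *)
Definition theta3 (tau : C) : C :=
  let q := Cexp (Ci * PI * tau) in
  let term (n : Z) := (q ^ Z.to_nat (n ^ 2))%C in
  (CSeries (fun n => term (Z.of_nat n))
   + CSeries (fun n => term (- Z.of_nat (S n))%Z))%C.

(* Euler's integral, meaningful for [0 < x]. *)
Definition Gamma (x : R) : R :=
  RInt_gen (fun t => Rpower t (x - 1) * exp (- t))
    (at_right 0) (Rbar_locally p_infty).

Definition Phi : R := Gamma (1 / 4) ^ 8 / (128 * PI ^ 4).

(* [d] is the integer sequence for which
     theta3 (i (1 + z) / (1 - z))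
       = theta3 i * (1 - z)^(1/2)
         * sum_(n >= 0) d n / (2 n)! * Phi^n * z^(2 n)
   on a neighbourhood of [z = 0]. By uniqueness of power series expansions
   and [theta3 i <> 0], [Phi <> 0], at most one [d] satisfies this. *)
Definition is_theta3_taylor (d : nat -> Z) : Prop :=
  locally (RtoC 0) (fun z : C =>
    exists s : C,
      is_series
        (fun n => RtoC (IZR (d n) / INR (fact (2 * n)) * Phi ^ n)
                  * z ^ (2 * n))%C s
      /\ theta3 (Ci * ((1 + z) / (1 - z)))%C
         = (theta3 Ci * Csqrt (1 - z) * s)%C).

(* 3 * 7 * 11 * ... * (4 m - 1) *)
Definition prod_4j_sub_1 (m : nat) : Z :=
  fold_right Z.mul 1%Z (map (fun j => 4 * Z.of_nat j - 1)%Z (seq 1 m)).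

(* Main.v *)
From Stdlib Require Import Reals ZArith Znumtheory List Lra Psatz.
From Coquelicot Require Coquelicot.
From mathcomp Require all_boot all_order all_algebra.
From mathcomp Require ring zify boolp.
Require Import Defs.

(** Write a = theta3^2, b = theta4^2 as series in q, and D = q d/dq. The duplication
    formulas 2 a(q^2) = a + b and b(q^2) = theta3 theta4 force a differential system
    (wronskian, second_order): the defect of each equation at q^2 is a multiple of
    the defect at q, so it has no lowest term. With kappa = (a^2 - b^2) / (16 a^2)
    and ell = D a / a^3, the system says that D theta, D kappa and D ell are
    polynomials in kappa and ell up to powers of a and theta. Hence
    (2 D)^n theta = theta a^(2 n) P_n(kappa, ell) with universal integer polynomials
    P_n (iter_D2_theta).

    On the imaginary axis the same system holds, and in the coordinate z, with
    ell suitably corrected, it becomes autonomous (Derive_n_G). The expansion at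
    z = 0 is even, and so P_1 and P_3 vanish there; this puts the base point at
    (kappa, ell) = (1/32, 0), and d(n) = 8^n P_(2 n)(1/32, 0)
    (taylor_coefficient). The normalisation, the value of theta3(i) in terms of
    Gamma(1/4), comes for free: the value 1 of d(1) follows from d(1) being an
    integer and a rough numerical estimate (Phi_value).

    The congruence originates at the cusp. With phi = p^(e-1) (p - 1), Euler's
    theorem applied to each coefficient gives
    (2 D)^(2 n + phi) theta = (2 D)^(2 n) theta modulo p^e if 2 n >= e, that is
    a^(2 phi) P_(2 n + phi)(kappa, ell) = P_(2 n)(kappa, ell). To carry this
    identity of q-series to the point (1/32, 0), it is made an identity of
    polynomials in kappa.

    - Let y_N(kappa) be the sum of (2 k choose k)^2 kappa^k over k < N. It satisfies
      a hypergeometric equation modulo N^2. For N = p^e this implies that ell is a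
      rational function of kappa modulo p^e, with denominator y_N (unit_root).
    - By the congruence of Lucas, y_p(kappa) a^(p-1) = 1 modulo p (hasse). So
      a^(2 phi) is the inverse of y_p(kappa)^(2 p^(e-1)) modulo p^e.
    - kappa is a local parameter at the cusp, so the resulting congruence holds
      between polynomials (sub_cong) and can be evaluated at an inverse of 32. By
      the symmetry kappa -> 1/16 - kappa the rational function representing ell
      vanishes there (W_yp_center), in agreement with the value ell = 0 at z = 0.

    Therefore P_(2 n + phi) = y_p(1/32)^(2 p^(e-1)) P_(2 n) modulo p^e at (1/32, 0)
    (P_cong). Finally y_p(1/32) modulo p is, up to a power of 2, the value at 0 of
    the Legendre polynomial of degree (p - 1) / 2 (hasse_value), and Wilson's theorem
    together with 2^((p-1)/2) = (-1)^((p-1)/4) evaluates 8^((p-1)/2) y_p(1/32)^2,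
    whose p^(e-1)-th power is the constant of the theorem (hasse_square). *)

(** * Terms for the polynomials P_n *)

Module Terms.

(** Polynomials in kappa and ell with integer coefficients, kept as terms because
    they are evaluated in many rings and inductions follow their syntax. *)
Inductive tm := Kap | Ell | Cst (z : Z) | Add (s t : tm) | Mul (s t : tm).

Section Eval.
Variables (T : Type) (add mul : T -> T -> T) (inj : Z -> T) (k l : T).

Fixpoint ev (t : tm) : T :=
  match t with
  | Kap => k
  | Ell => l
  | Cst z => inj z
  | Add s t => add (ev s) (ev t)
  | Mul s t => mul (ev s) (ev t)
  end.

End Eval.

Definition kap_1_sub : tm := Mul Kap (Add (Cst 1) (Mul (Cst (- 16)) Kap)).

(** The derivation 2 a^-2 q d/dq on polynomials in the q-series kappa and ell. The
    derivative in the coordinate z is the same one up to a multiple of G^4. *)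
Fixpoint dt (t : tm) : tm :=
  match t with
  | Kap => Mul (Cst 2) kap_1_sub
  | Ell => Add (Mul (Cst 8) kap_1_sub) (Mul (Cst (- 2)) (Mul Ell Ell))
  | Cst _ => Cst 0
  | Add s t => Add (dt s) (dt t)
  | Mul s t => Add (Mul (dt s) t) (Mul s (dt t))
  end.

(** The recursion reflects that the weight of theta a^(2 n) is (4 n + 1) / 2. *)
Fixpoint P (n : nat) : tm :=
  match n with
  | O => Cst 1
  | S n => Add (dt (P n)) (Mul (Mul (Cst (4 * Z.of_nat n + 1)) Ell) (P n))
  end.

End Terms.

(** * Formal power series *)

Module PowerSeries.
Import HB.structures all_boot all_order all_algebra ring zify boolp.
Import GRing.Theory.
Set Implicit Arguments. Unset Strict Implicit. Unset Printing Implicit Defensive.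
Local Open Scope ring_scope.

Record fps (R : Type) := Fps { cf : nat -> R }.

Lemma fpsP (R : Type) (f g : fps R) : (forall n, cf f n = cf g n) -> f = g.
Proof. by case: f g => [f] [g] /= /funext ->. Qed.

HB.instance Definition _ (R : Type) := gen_eqMixin (fps R).
HB.instance Definition _ (R : Type) := gen_choiceMixin (fps R).

Section Ring.
Variable R : comNzRingType.
Implicit Types f g h : fps R.

Definition fps0 : fps R := Fps (fun=> 0).
Definition fpsadd f g : fps R := Fps (fun n => cf f n + cf g n).
Definition fpsopp f : fps R := Fps (fun n => - cf f n).
Definition fpsC (c : R) : fps R := Fps (fun n => if n == 0 then c else 0).
Definition fpsmul f g : fps R :=
  Fps (fun n => \sum_(i < n.+1) cf f i * cf g (n - i)%N).

Fact fpsaddA : associative fpsadd.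
Proof. by move=> f g h; apply: fpsP => n /=; rewrite addrA. Qed.
Fact fpsaddC : commutative fpsadd.
Proof. by move=> f g; apply: fpsP => n /=; rewrite addrC. Qed.
Fact fpsadd0 : left_id fps0 fpsadd.
Proof. by move=> f; apply: fpsP => n /=; rewrite add0r. Qed.
Fact fpsaddN : left_inverse fps0 fpsopp fpsadd.
Proof. by move=> f; apply: fpsP => n /=; rewrite addNr. Qed.

HB.instance Definition _ := GRing.isZmodule.Build (fps R)
  fpsaddA fpsaddC fpsadd0 fpsaddN.

Definition trunc (N : nat) f : {poly R} := \poly_(i < N.+1) cf f i.

Lemma coef_trunc N f n : (n <= N)%N -> (trunc N f)`_n = cf f n.
Proof. by move=> le_nN; rewrite coef_poly ltnS le_nN. Qed.

(** A coefficient of a product only involves finitely many coefficients of the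
    factors, so the ring axioms are inherited from polynomials. *)
Lemma coef_trunc_mul N f g n : (n <= N)%N ->
  (trunc N f * trunc N g)`_n = cf (fpsmul f g) n.
Proof.
move=> le_nN; rewrite coefM; apply: eq_bigr => i _.
by rewrite !coef_trunc //; have := ltn_ord i; lia.
Qed.

Fact fpsmulA : associative fpsmul.
Proof.
move=> f g h; apply: fpsP => n.
transitivity ((trunc n f * (trunc n g * trunc n h))`_n).
  rewrite coefM; apply: eq_bigr => i _.
  by rewrite coef_trunc_mul ?coef_trunc ?leq_subr //; have := ltn_ord i; lia.
rewrite mulrA coefM; apply: eq_bigr => i _.
by rewrite coef_trunc_mul ?coef_trunc ?leq_subr //; have := ltn_ord i; lia.
Qed.
Fact fpsmulC : commutative fpsmul.
Proof.
by move=> f g; apply: fpsP => n; rewrite -!(coef_trunc_mul _ _ (leqnn n)) mulrC.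
Qed.
Fact fpsmul1 : left_id (fpsC 1) fpsmul.
Proof.
move=> f; apply: fpsP => n /=; rewrite big_ord_recl /= mul1r subn0.
by rewrite big1 ?addr0 // => i _; rewrite mul0r.
Qed.
Fact fpsmulDl : left_distributive fpsmul fpsadd.
Proof.
move=> f g h; apply: fpsP => n /=; rewrite -big_split.
by apply: eq_bigr => i _; rewrite mulrDl.
Qed.
Fact fps1_neq0 : fpsC 1 != 0.
Proof. by apply/eqP => /(congr1 (fun f => cf f 0)) /= /eqP; rewrite oner_eq0. Qed.

HB.instance Definition _ := GRing.Zmodule_isComNzRing.Build (fps R)
  fpsmulA fpsmulC fpsmul1 fpsmulDl fps1_neq0.

Lemma cfD f g n : cf (f + g) n = cf f n + cf g n. Proof. by []. Qed.
Lemma cfB f g n : cf (f - g) n = cf f n - cf g n. Proof. by []. Qed.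
Lemma cfM f g n : cf (f * g) n = \sum_(i < n.+1) cf f i * cf g (n - i)%N.
Proof. by []. Qed.
Lemma cf0 n : cf (0 : fps R) n = 0. Proof. by []. Qed.
Lemma cf1 n : cf (1 : fps R) n = (n == 0)%:R. Proof. by rewrite /=; case: eqP. Qed.

Lemma cfM0 f g : cf (f * g) 0 = cf f 0 * cf g 0.
Proof. by rewrite cfM big_ord1. Qed.
Lemma cfX0 f k : cf (f ^+ k) 0 = cf f 0 ^+ k.
Proof. by elim: k => [|k IH]; rewrite ?cf1 // !exprS cfM0 IH. Qed.
Lemma cfM1 f g : cf (f * g) 1 = cf f 0 * cf g 1 + cf f 1 * cf g 0.
Proof. by rewrite cfM big_ord_recr big_ord1. Qed.

Lemma cf_sum I (r : seq I) (P : pred I) (F : I -> fps R) n :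
  cf (\sum_(i <- r | P i) F i) n = \sum_(i <- r | P i) cf (F i) n.
Proof. by apply: (big_morph (fun f => cf f n)) => //. Qed.

Lemma cfMn f k n : cf (f *+ k) n = cf f n *+ k.
Proof. by elim: k => [|k IH]; rewrite ?mulr0n // !mulrS cfD IH. Qed.

Lemma cf_natmul k f n : cf (k%:R * f) n = k%:R * cf f n.
Proof. by rewrite !mulr_natl cfMn. Qed.

Fact fpsC_is_additive : additive fpsC.
Proof. by move=> x y; apply: fpsP => n /=; case: eqP; rewrite ?subrr. Qed.
Fact fpsC_is_multiplicative : multiplicative fpsC.
Proof.
split=> [x y|//]; apply: fpsP => n; rewrite cfM big_ord_recl /= subn0.
rewrite big1 ?addr0 => [|i _]; last by rewrite mul0r.
by case: eqP; rewrite ?mulr0.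
Qed.
HB.instance Definition _ := GRing.isAdditive.Build R (fps R) fpsC fpsC_is_additive.
HB.instance Definition _ :=
  GRing.isMultiplicative.Build R (fps R) fpsC fpsC_is_multiplicative.

Lemma cfCM c f n : cf (fpsC c * f) n = c * cf f n.
Proof.
rewrite cfM big_ord_recl /= subn0 big1 ?addr0 // => i _.
by rewrite mul0r.
Qed.

(** ** Order of vanishing *)

Definition vanish (n : nat) f := forall i, (i < n)%N -> cf f i = 0.

Lemma vanishM n m f g : vanish n f -> vanish m g -> vanish (n + m) (f * g).
Proof.
move=> f0 g0 i lt_i; rewrite cfM big1 // => j _.
have [lt_jn|le_nj] := ltnP j n; first by rewrite f0 ?mul0r.
by rewrite g0 ?mulr0 //; have := ltn_ord j; lia.
Qed.

Lemma vanishX n f k : vanish n f -> vanish (n * k) (f ^+ k).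
Proof.
move=> f0; elim: k => [|k IH]; first by rewrite muln0.
by rewrite exprS mulnS; apply: vanishM.
Qed.

Lemma vanish_le n m f : (m <= n)%N -> vanish n f -> vanish m f.
Proof. by move=> le_mn f0 i lt_i; apply: f0; apply: leq_trans le_mn. Qed.

Lemma cf_mul_low n f g : vanish n g -> cf (f * g) n = cf f 0 * cf g n.
Proof.
move=> g0; rewrite cfM big_ord_recl subn0 /= big1 ?addr0 // => i _.
by rewrite g0 ?mulr0 // /bump /=; have := ltn_ord i; lia.
Qed.

Lemma cf_mul_low1 n f g : cf f 0 = 0 -> vanish n g ->
  cf (f * g) n.+1 = cf f 1 * cf g n.
Proof.
move=> f0 g0; rewrite cfM big_ord_recl f0 mul0r add0r big_ord_recl subSS subn0.
rewrite big1 ?addr0 // => i _.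
rewrite g0 ?mulr0 //; change (n.+1 - i.+2 < n)%N.
by have := ltn_ord i; lia.
Qed.

(** The inverse 1 / f of a series with constant term 1, as the geometric series
    of 1 - f. *)
Definition finv f : fps R :=
  Fps (fun n => cf (\sum_(k < n.+1) (1 - f) ^+ k) n).

Lemma mul_finv f : cf f 0 = 1 -> f * finv f = 1.
Proof.
move=> f0; pose g := 1 - f.
have g0 k : vanish k (g ^+ k).
  rewrite -{1}[k]mul1n; apply: vanishX => i; rewrite ltnS leqn0 => /eqP ->.
  by rewrite cfB cf1 f0 subrr.
have stable n N : (n <= N)%N ->
    cf (\sum_(k < n.+1) g ^+ k) n = cf (\sum_(k < N.+1) g ^+ k) n.
  move=> /subnKC <-; elim: (N - n)%N => [|d IH]; first by rewrite addn0.
  by rewrite IH addnS [in RHS]big_ord_recr cfD (g0 (n + d).+1 n) ?addr0 // ltnS leq_addr.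
apply: fpsP => n.
transitivity (cf (f * \sum_(k < n.+1) g ^+ k) n).
  rewrite !cfM; apply: eq_bigr => i _; congr (_ * _).
  by rewrite /= (stable _ n) // leq_subr.
have -> : f = 1 - g by rewrite /g; ring.
have -> : (1 - g) * (\sum_(k < n.+1) g ^+ k) = 1 - g ^+ n.+1.
  rewrite -[in RHS](expr1n _ n.+1) subrXX; congr (_ * _).
  by apply: eq_bigr => i _; rewrite expr1n mul1r.
by rewrite cfB (g0 n.+1 n) // subr0.
Qed.

Lemma cf_finv0 f : cf (finv f) 0 = 1.
Proof. by rewrite /= big_ord1 expr0. Qed.

(** ** The derivation q d/dq *)

Definition D f : fps R := Fps (fun n => n%:R * cf f n).

Lemma cf_D f n : cf (D f) n = n%:R * cf f n. Proof. by []. Qed.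

Fact D_is_additive : additive D.
Proof. by move=> f g; apply: fpsP => n; rewrite /= mulrBr. Qed.
HB.instance Definition _ := GRing.isAdditive.Build (fps R) (fps R) D D_is_additive.

Lemma DM f g : D (f * g) = D f * g + f * D g.
Proof.
apply: fpsP => n; rewrite cf_D cfD !cfM mulr_sumr -big_split.
apply: eq_bigr => i _ /=; rewrite -{1}(subnKC (n := n) (m := i)) ?natrD; last by have := ltn_ord i; lia.
ring.
Qed.

Lemma D1 : D 1 = 0.
Proof. by apply: fpsP => -[|n]; rewrite /= ?mul0r ?mulr0. Qed.

Lemma DX f k : D (f ^+ k.+1) = k.+1%:R * f ^+ k * D f.
Proof.
elim: k => [|k IH]; first by rewrite !expr1 expr0; ring.
by rewrite exprS DM IH (exprS f k) -[k.+2%:R]natr1; ring.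
Qed.

Lemma DC c : D (fpsC c) = 0.
Proof. by apply: fpsP => -[|n]; rewrite /= ?mul0r ?mulr0. Qed.

Lemma Dnat k : D k%:R = 0.
Proof. by rewrite -(rmorph_nat fpsC) DC. Qed.

(** ** Substitution of a series into a polynomial *)

Definition subst (k : fps R) : {poly R} -> fps R := horner_eval k \o map_poly fpsC.
HB.instance Definition _ k := GRing.RMorphism.copy (subst k)
  (horner_eval k \o map_poly fpsC).

Lemma subst_wide k (p : {poly R}) N : (size p <= N)%N ->
  subst k p = \sum_(i < N) fpsC p`_i * k ^+ i.
Proof.
move=> le_pN; rewrite /subst /= /horner_eval (@horner_coef_wide _ N).
  by apply: eq_bigr => i _; rewrite coef_map.
exact: leq_trans (size_poly _ _) le_pN.
Qed.

Lemma substX k : subst k 'X = k.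
Proof. by rewrite /subst /= /horner_eval map_polyX hornerX. Qed.

Lemma substC k c : subst k c%:P = fpsC c.
Proof. by rewrite /subst /= /horner_eval map_polyC hornerC. Qed.

Lemma substD k (p q : {poly R}) : subst k (p + q) = subst k p + subst k q.
Proof. exact: rmorphD. Qed.
Lemma substM k (p q : {poly R}) : subst k (p * q) = subst k p * subst k q.
Proof. exact: rmorphM. Qed.

Lemma D_subst k (p : {poly R}) : D (subst k p) = subst k p^`() * D k.
Proof.
elim/poly_ind: p => [|p c IH]; first by rewrite deriv0 !rmorph0 raddf0 mul0r.
rewrite derivMXaddC !substD !substM substX substC raddfD /= DC DM IH; ring.
Qed.

Lemma cf_subst0 k (p : {poly R}) : cf k 0 = 0 -> cf (subst k p) 0 = p`_0.
Proof.
move=> k0; elim/poly_ind: p => [|p c _]; first by rewrite rmorph0 coef0.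
rewrite substD substM substX substC cfD cfM0 k0 mulr0 add0r.
by rewrite coefD coefMX coefC /= add0r.
Qed.

(** A series with vanishing constant term and leading coefficient 1 is a local
    parameter, hence transcendental over the coefficients. *)
Lemma subst_inj k (p : {poly R}) : cf k 0 = 0 -> cf k 1 = 1 -> subst k p = 0 -> p = 0.
Proof.
move=> k0 k1; have vk : vanish 1 k by case.
have kn n : cf (k ^+ n) n = 1.
  elim: n => [|n IH]; first by rewrite cf1.
  have vkn : vanish n (k ^+ n) by rewrite -{1}[n]mul1n; apply: vanishX.
  rewrite exprSr cfM big_ord_recr big_ord_recr /= subnn k0 mulr0 addr0.
  rewrite subSnn k1 mulr1 IH big1 ?add0r // => i _.
  by rewrite vkn ?mul0r.
move=> pk0; apply/polyP => n; rewrite coef0.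
elim/ltn_ind: n => n IH.
have := congr1 (fun f => cf f n) pk0.
rewrite (@subst_wide _ _ (size p + n.+1)) ?leq_addr // cf_sum cf0.
have lt_n : (n < size p + n.+1)%N by lia.
have high (i : 'I_(size p + n.+1)) : i != Ordinal lt_n -> cf (fpsC p`_i * k ^+ i) n = 0.
  move=> ne_in; rewrite cfCM; case: (ltngtP i n) => [lt_in|gt_in|eq_in].
  - by rewrite IH ?mul0r.
  - have vki : vanish i (k ^+ i) by rewrite -{1}[val i]mul1n; apply: vanishX.
    by rewrite vki ?mulr0.
  - by rewrite -val_eqE /= eq_in eqxx in ne_in.
by rewrite (bigD1 (Ordinal lt_n)) // big1 // Monoid.mulm1 cfCM kn mulr1.
Qed.

End Ring.

(** ** Change of coefficients *)

Section Map.
Variables (R S : comNzRingType) (phi : {rmorphism R -> S}).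

Definition fmap (f : fps R) : fps S := Fps (fun n => phi (cf f n)).

Fact fmap_is_additive : additive fmap.
Proof. by move=> f g; apply: fpsP => n; rewrite /= raddfB. Qed.
Fact fmap_is_multiplicative : multiplicative fmap.
Proof.
split=> [f g|]; apply: fpsP => n.
  by rewrite /= rmorph_sum; apply: eq_bigr => i _; rewrite rmorphM.
by rewrite /=; case: eqP; rewrite ?rmorph0 ?rmorph1.
Qed.
HB.instance Definition _ := GRing.isAdditive.Build (fps R) (fps S) fmap fmap_is_additive.
HB.instance Definition _ :=
  GRing.isMultiplicative.Build (fps R) (fps S) fmap fmap_is_multiplicative.

Lemma fmapC c : fmap (fpsC c) = fpsC (phi c).
Proof. by apply: fpsP => n /=; case: eqP; rewrite ?rmorph0. Qed.

Lemma fmap_subst k (p : {poly R}) : fmap (subst k p) = subst (fmap k) (map_poly phi p).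
Proof.
elim/poly_ind: p => [|p c IH]; first by rewrite !rmorph0.
rewrite !rmorphD !rmorphM /= map_polyX map_polyC /= !substX !substC.
by rewrite IH fmapC.
Qed.

End Map.

(** ** The substitutions of the square and of the opposite of the variable *)

Section Dilations.
Variable R : comNzRingType.
Implicit Types f g : fps R.

Definition sqvar f : fps R :=
  Fps (fun n => if (2 %| n)%N then cf f (n %/ 2) else 0).

Lemma coef_trunc_sqvar N f n : (n <= N)%N ->
  (trunc N f \Po 'X^2)`_n = cf (sqvar f) n.
Proof.
move=> le_nN; rewrite coef_comp_poly_Xn //=; case: ifP => // _.
by rewrite coef_trunc // (leq_trans (leq_div _ _)).
Qed.

Fact sqvar_is_additive : additive sqvar.
Proof. by move=> f g; apply: fpsP => n /=; case: ifP; rewrite ?subrr. Qed.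
Fact sqvar_is_multiplicative : multiplicative sqvar.
Proof.
split=> [f g|]; apply: fpsP => n; last first.
  rewrite cf1 /= ; case: ifP => [/dvdnP[m ->]|]; last by case: n.
  by rewrite mulnK //; case: m.
transitivity (((trunc n f \Po 'X^2) * (trunc n g \Po 'X^2))`_n).
  rewrite -rmorphM /= coef_comp_poly_Xn //=; case: ifP => // _.
  by rewrite coef_trunc_mul // leq_div.
rewrite coefM; apply: eq_bigr => i _.
by rewrite !coef_trunc_sqvar //; have := ltn_ord i; lia.
Qed.
HB.instance Definition _ :=
  GRing.isAdditive.Build (fps R) (fps R) sqvar sqvar_is_additive.
HB.instance Definition _ :=
  GRing.isMultiplicative.Build (fps R) (fps R) sqvar sqvar_is_multiplicative.

Lemma cf_sqvar_double f n : cf (sqvar f) n.*2 = cf f n.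
Proof. by rewrite /= -muln2 dvdn_mull // mulnK. Qed.

Lemma cf_sqvar_odd f n : odd n -> cf (sqvar f) n = 0.
Proof. by rewrite /= dvdn2 => ->. Qed.

Lemma vanish_sqvar n f : vanish n f -> vanish n.*2 (sqvar f).
Proof.
move=> f0 i lt_i; rewrite /=; case: ifP => // /dvdnP[j ei].
by rewrite ei mulnK // f0 //; lia.
Qed.

Lemma D_sqvar f : D (sqvar f) = 2%:R * sqvar (D f).
Proof.
apply: fpsP => n; rewrite cf_natmul; have [od|ev] := boolP (odd n).
  by rewrite cf_D !cf_sqvar_odd ?mulr0.
rewrite -(even_halfK ev) cf_D !cf_sqvar_double cf_D mulrA -natrM.
by rewrite mul2n.
Qed.

Definition negvar f : fps R := Fps (fun n => (-1) ^+ n * cf f n).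

Lemma cf_negvar f n : cf (negvar f) n = (-1) ^+ n * cf f n. Proof. by []. Qed.

Fact negvar_is_additive : additive negvar.
Proof. by move=> f g; apply: fpsP => n; rewrite /= mulrBr. Qed.
Fact negvar_is_multiplicative : multiplicative negvar.
Proof.
split=> [f g|]; apply: fpsP => n; last first.
  by case: n => [|n] /=; rewrite ?expr0 ?mulr1 ?mulr0.
rewrite /= mulr_sumr; apply: eq_bigr => i _.
rewrite -{1}(subnKC (n := n) (m := i)) ?exprD; last by have := ltn_ord i; lia.
ring.
Qed.
HB.instance Definition _ :=
  GRing.isAdditive.Build (fps R) (fps R) negvar negvar_is_additive.
HB.instance Definition _ :=
  GRing.isMultiplicative.Build (fps R) (fps R) negvar negvar_is_multiplicative.

Lemma negvarK : involutive negvar.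
Proof.
by move=> f; apply: fpsP => n; rewrite /= mulrA -expr2 sqrr_sign mul1r.
Qed.

End Dilations.
End PowerSeries.

(** * The theta function as a q-series and its differential system *)

Module ThetaSeries.
Import HB.structures all_boot all_order all_algebra ring zify.
Import GRing.Theory.
Import PowerSeries.
Set Implicit Arguments. Unset Strict Implicit. Unset Printing Implicit Defensive.
Local Open Scope ring_scope.

Fixpoint ints (B : nat) : seq int :=
  if B is B'.+1 then B%:Z :: - B%:Z :: ints B' else [:: 0].

Lemma mem_ints B (m : int) : (m \in ints B) = (absz m <= B)%N.
Proof.
elim: B => [|B IH]; first by rewrite /= inE; lia.
by rewrite /= !inE IH; lia.
Qed.

Lemma uniq_ints B : uniq (ints B).
Proof. by elim: B => //= B ->; rewrite !inE !mem_ints; lia. Qed.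

(** The generating series of these counts is theta. *)
Definition nsqrt (n : nat) : nat := count (fun m : int => absz m ^ 2 == n)%N (ints n).

Lemma nsqrt_wide n B : (n <= B)%N ->
  nsqrt n = (\sum_(m <- ints B) (absz m ^ 2 == n))%N.
Proof.
have -> : nsqrt n = (\sum_(m <- ints n) (absz m ^ 2 == n))%N.
  by rewrite /nsqrt -sum1_count big_mkcond; apply: eq_bigr => m _; case: eqP.
elim: B => [|B IH]; first by rewrite leqn0 => /eqP ->.
rewrite leq_eqVlt => /orP[/eqP -> //|]; rewrite ltnS => le_nB.
have big (m : int) : absz m = B.+1 -> (absz m ^ 2 == n)%N = false.
  move=> ->; rewrite -mulnn; case: eqP => // e. have: (n <= B)%N by [].
  by rewrite -e mulSn; lia.
by rewrite IH // !big_cons !big // abszN.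
Qed.

Lemma nsqrt0 : nsqrt 0 = 1%N. Proof. by []. Qed.

Lemma nsqrt_pos n : (0 < n)%N ->
  nsqrt n = (2 * \sum_(j < n) (j.+1 ^ 2 == n))%N.
Proof.
move=> n_gt0; rewrite (@nsqrt_wide n n) //.
have sym B : (\sum_(m <- ints B) (absz m ^ 2 == n) =
              2 * \sum_(j < B) (j.+1 ^ 2 == n))%N.
  elim: B => [|B IH]; first by rewrite big_seq1 big_ord0 /=; case: n n_gt0.
  rewrite !big_cons IH big_ord_recr abszN [`|_|%N]/=.
  by rewrite addnA addnn -mul2n addnC mulnDr.
exact: sym.
Qed.

Lemma nsqrt_sqr k : nsqrt (k.+1 ^ 2) = 2.
Proof.
rewrite nsqrt_pos ?expn_gt0 //.
have lt_k : (k < k.+1 ^ 2)%N by rewrite -mulnn; nia.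
rewrite (bigD1 (Ordinal lt_k)) //= eqxx big1 // => i ne_ik.
rewrite eqn_exp2r // eqSS; case: eqP => // e.
by rewrite -val_eqE /= e eqxx in ne_ik.
Qed.

Lemma nsqrt_gap k n : (k ^ 2 < n < k.+1 ^ 2)%N -> nsqrt n = 0%N.
Proof.
move=> gap; rewrite (@nsqrt_wide _ n) // big1_seq // => m _.
case: eqP => // e; exfalso; move: gap; rewrite -e !ltn_exp2r //; lia.
Qed.

Lemma nsqrt_square n : nsqrt n <> 0%N -> exists c, (c ^ 2 = n)%N.
Proof.
move=> nz; have : has (fun m : int => absz m ^ 2 == n)%N (ints n).
  by move: nz; rewrite has_count /nsqrt; case: (count _ _).
by case/hasP => m _ /eqP <-; exists (absz m).
Qed.

Definition sols (n : nat) : seq (int * int) :=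
  [seq z <- [seq (i, j) | i <- ints n, j <- ints n]
  | absz z.1 ^ 2 + absz z.2 ^ 2 == n]%N.

Lemma mem_sols n z : (z \in sols n) = (absz z.1 ^ 2 + absz z.2 ^ 2 == n)%N.
Proof.
have le_sqr (x : nat) : (x <= x ^ 2)%N by rewrite -mulnn; case: x => // x; nia.
have := le_sqr (absz z.1); have := le_sqr (absz z.2).
rewrite mem_filter; case: eqP => //= e le2 le1; apply/allpairsP; exists z.
rewrite !mem_ints; split; last (by case: z {e le1 le2}); rewrite -e; [exact: leq_trans le1 (leq_addr _ _) | exact: leq_trans le2 (leq_addl _ _)].
Qed.

Lemma uniq_sols n : uniq (sols n).
Proof.
by apply/filter_uniq/allpairs_uniq; rewrite ?uniq_ints // => -[? ?] [? ?].
Qed.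

Lemma parity_sum (c d : int) n :
  (absz c ^ 2 + absz d ^ 2 = n.*2)%N -> exists c1 : int, c + d = c1 * 2.
Proof.
move=> e; exists ((c + d) %/ 2)%Z; rewrite divzK //.
have : ~~ odd (absz c ^ 2 + absz d ^ 2) by rewrite e odd_double.
by rewrite oddD !oddX /=; lia.
Qed.

(** Multiplication by 1 + i maps the Gaussian integers of norm n onto those of
    norm 2 n. *)
Lemma size_sols_double n : size (sols n.*2) = size (sols n).
Proof.
pose f (z : int * int) := (z.1 + z.2, z.1 - z.2).
rewrite -(size_map f (sols n)); apply/esym/perm_size/uniq_perm.
- by rewrite map_inj_uniq ?uniq_sols // => -[a b] [c d] [/= ? ?]; congr pair; lia.
- exact: uniq_sols.
move=> [c d]; rewrite mem_sols /=; apply/mapP/idP => [[[a b]]|/eqP e].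
  by rewrite mem_sols /= => /eqP e [-> ->]; apply/eqP; nia.
have [c1 c_eq] : exists c1 : int, (c + d = c1 * 2)%R.
  by apply: (@parity_sum _ _ n).
exists (c1, c1 - d); last by congr pair => /=; lia.
by rewrite mem_sols /=; apply/eqP; nia.
Qed.

Lemma nsqrt_convolution n :
  (\sum_(i < n.+1) nsqrt i * nsqrt (n - i) = size (sols n))%N.
Proof.
have inner (a b : nat) :
    (\sum_(i < n.+1) (a == i) * (b == n - i) = (a + b == n)%N)%N.
  have [le_an|lt_na] := leqP a n; last first.
    rewrite big1 => [|i _]; first by case: eqP => //; lia.
    by have := ltn_ord i; case: eqP => //; lia.
  have lt_a : (a < n.+1)%N by lia.
  rewrite (bigD1 (Ordinal lt_a)) //= eqxx mul1n big1 => [|i ne_ia].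
    by rewrite addn0; do 2 case: eqP; lia.
  suff /negbTE -> : a != i by [].
  by apply: contra ne_ia => /eqP a_i; apply/eqP/val_inj.
transitivity (\sum_(i < n.+1) \sum_(m <- ints n) \sum_(k <- ints n)
                (absz m ^ 2 == i) * (absz k ^ 2 == n - i))%N.
  apply: eq_bigr => i _; have le_in : (i <= n)%N by rewrite -ltnS.
  rewrite (nsqrt_wide le_in) (nsqrt_wide (leq_subr i n)) big_distrl.
  by apply: eq_bigr => m _; rewrite big_distrr.
rewrite exchange_big size_filter -sum1_count [in RHS]big_mkcond big_allpairs_dep.
apply: eq_bigr => m _; rewrite exchange_big; apply: eq_bigr => k _.
by rewrite inner; case: eqP.
Qed.

Definition theta : fps int := Fps (fun n => (nsqrt n)%:Z).
Definition theta4 : fps int := negvar theta.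
(* Locked, so that rewriting does not see through the names. *)
Definition a : fps int := locked (theta ^+ 2).
Definition b : fps int := locked (theta4 ^+ 2).

Lemma aE : a = theta ^+ 2. Proof. by rewrite /a -lock. Qed.
Lemma bE : b = theta4 ^+ 2. Proof. by rewrite /b -lock. Qed.

Lemma cf_a n : cf a n = (size (sols n))%:Z.
Proof.
rewrite aE expr2 cfM -nsqrt_convolution -natz natr_sum.
by apply: eq_bigr => i _; rewrite natrM !natz.
Qed.

(** The even part of theta3^2 is theta3^2(q^2), by the count of Gaussian integers
    of even norm. *)
Lemma dupl_sum : 2%:R * sqvar a = a + b.
Proof.
have -> : b = negvar a by rewrite bE aE /theta4 -rmorphXn.
apply: fpsP => n; rewrite cf_natmul cfD cf_negvar.
rewrite -[X in X + _]mul1r -mulrDl -signr_odd.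
have [od|ev] := boolP (odd n); first by rewrite cf_sqvar_odd // expr1 subrr mul0r mulr0.
by rewrite -(even_halfK ev) cf_sqvar_double !cf_a size_sols_double.
Qed.

(** In theta(q) theta(-q) only i^2 + j^2 = 2 k occurs; then i and j have the same
    parity as k, so the signs are those of theta4^2 at q^2. *)
Lemma dupl_prod : sqvar b = theta * theta4.
Proof.
have -> : b = negvar a by rewrite bE aE /theta4 -rmorphXn.
apply: fpsP => n; have [od|ev] := boolP (odd n).
  rewrite cf_sqvar_odd //.
  have : negvar (theta * theta4) = theta * theta4.
    by rewrite rmorphM /= /theta4 negvarK mulrC.
  move/(congr1 (fun f => cf f n)); rewrite cf_negvar -signr_odd od expr1 mulN1r.
  by lia.
rewrite -(even_halfK ev); move: n./2 => k {n ev}.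
rewrite cf_sqvar_double cf_negvar cf_a -size_sols_double.
rewrite -nsqrt_convolution -natz natr_sum mulr_sumr cfM.
apply: eq_bigr => i _; rewrite cf_negvar /= natrM !natz.
have [z1|/eqP n1] := eqVneq (nsqrt i) 0%N; first by rewrite z1 !mul0r mulr0.
have [z2|/eqP n2] := eqVneq (nsqrt (k.*2 - i)) 0%N; first by rewrite z2 !mulr0.
suff -> : (-1) ^+ (k.*2 - i)%N = (-1) ^+ k :> int by ring.
have le_i : (i <= k.*2)%N by rewrite -ltnS.
have [c ec] := nsqrt_square n1; have [d ed] := nsqrt_square n2.
rewrite -[LHS]signr_odd -[RHS]signr_odd; congr (_ ^+ _); congr nat_of_bool.
have eo : odd c = odd d.
  have := congr1 odd (subnKC le_i); rewrite -ed -ec oddD !oddX /= odd_double.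
  by case: odd; case: odd.
have [c1 ec1] : exists c1, c = (c1.*2 + odd c)%N by exists c./2; rewrite addnC odd_double_half.
have [d1 ed1] : exists d1, d = (d1.*2 + odd d)%N by exists d./2; rewrite addnC odd_double_half.
rewrite -ed oddX /= -eo; have := subnKC le_i; rewrite -ed -ec {}ec1 {}ed1 -eo.
case: (odd c); rewrite -!mulnn; lia.
Qed.

Lemma theta_0 : cf theta 0 = 1. Proof. by []. Qed.
Lemma theta_1 : cf theta 1 = 2. Proof. by []. Qed.
Lemma theta4_0 : cf theta4 0 = 1. Proof. by []. Qed.
Lemma theta4_1 : cf theta4 1 = - 2%:R. Proof. by []. Qed.
Lemma a_0 : cf a 0 = 1. Proof. by rewrite aE cfX0. Qed.
Lemma b_0 : cf b 0 = 1. Proof. by rewrite bE cfX0. Qed.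
Lemma a_1 : cf a 1 = 4. Proof. by rewrite aE expr2 cfM1 theta_0 theta_1. Qed.
Lemma b_1 : cf b 1 = - 4%:R.
Proof. by rewrite bE expr2 cfM1 theta4_0 theta4_1. Qed.

(** By the duplication formulas, the defect V of this equation satisfies
    16 theta3 theta4 V(q^2) = 2 (a - b) V(q). Since a - b starts with 8 q, a lowest
    term c q^n of V with n > 1 would give a term of order n + 1 on the right, while
    the left side starts at order 2 n. *)
Lemma wronskian :
  2%:R * (b * D a - a * D b) = a * b * (a ^+ 2 - b ^+ 2).
Proof.
pose V : fps int := 2%:R * (b * D a - a * D b) - a * b * (a ^+ 2 - b ^+ 2).
suff : V = 0 by move/eqP; rewrite subr_eq0 => /eqP.
have V0 : cf V 0 = 0.
  rewrite cfB cf_natmul cfB !cfM0 !cf_D !cfB !cfX0.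
  by rewrite a_0 b_0; ring.
have V1 : cf V 1 = 0.
  rewrite /V aE bE !expr2 !(cfB, cf_natmul, cfM1, cfM0, cf_D).
  by rewrite theta_0 theta4_0 theta_1 theta4_1.
have recurrence : 16%:R * (theta * theta4) * sqvar V = 2%:R * ((a - b) * V).
  have eA : 2%:R * sqvar a = theta ^+ 2 + theta4 ^+ 2 by rewrite dupl_sum aE bE.
  have eA' : 4%:R * sqvar (D a) = 2%:R * (theta * D theta + theta4 * D theta4).
    transitivity (D (2%:R * sqvar a)).
      by rewrite DM Dnat D_sqvar; ring.
    by rewrite eA raddfD /= !DX; ring.
  have eB' : 2%:R * sqvar (D b) = theta4 * D theta + theta * D theta4.
    by rewrite -D_sqvar dupl_prod DM; ring.
  have -> : sqvar V = 2%:R * (sqvar b * sqvar (D a) - sqvar a * sqvar (D b))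
      - sqvar a * sqvar b * (sqvar a ^+ 2 - sqvar b ^+ 2).
    by rewrite /V !(rmorphB, rmorphM, rmorphXn, rmorph_nat).
  rewrite dupl_prod.
  set A := sqvar a in eA *; set A' := sqvar (D a) in eA' *.
  set B' := sqvar (D b) in eB' *.
  have eDa : D a = 2%:R * theta * D theta by rewrite aE DX; ring.
  have eDb : D b = 2%:R * theta4 * D theta4 by rewrite bE DX; ring.
  rewrite /V eDa eDb aE bE.
  transitivity (theta * theta4 * (8%:R * (theta * theta4) * (4%:R * A') - 8%:R * (2%:R * A) * (2%:R * B')
    - 2%:R * (2%:R * A) ^+ 3 * (theta * theta4)
    + 8%:R * (2%:R * A) * (theta * theta4) ^+ 3)); first by ring.
  rewrite eA' eB' eA; ring.
have van n : vanish n.+2 V.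
  elim: n => [|n IH] i; first by case: i => [|[|i]].
  rewrite ltnS leq_eqVlt => /orP[/eqP ->|/IH //].
  have ab0 : cf (a - b) 0 = 0 by rewrite cfB a_0 b_0 subrr.
  have ab1 : cf (a - b) 1 = 8 by rewrite cfB a_1 b_1.
  have low := cf_mul_low1 ab0 IH.
  have high : cf (theta * theta4 * sqvar V) n.+3 = 0.
    apply: (@vanishM _ 0 n.+4 (theta * theta4)) => //.
    by apply: vanish_le (vanish_sqvar IH); lia.
  have := congr1 (fun f => cf f n.+3) recurrence.
  rewrite -[X in X = _]/(cf _ n.+3) -[X in _ = X]/(cf _ n.+3) -mulrA !cf_natmul.
  by rewrite low high ab1; lia.
by apply: fpsP => n; apply: (van n).
Qed.

Lemma natmul_inj k (f g : fps int) : (0 < k)%N -> k%:R * f = k%:R * g -> f = g.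
Proof.
move=> k_gt0 e; apply: fpsP => n; have := congr1 (fun h => cf h n) e.
rewrite -[X in X = _]/(cf _ n) -[X in _ = X]/(cf _ n) !cf_natmul => /mulfI; apply.
by rewrite Num.Theory.pnatr_eq0 -lt0n.
Qed.

Definition second_order_defect : fps int :=
  4%:R * (a * D (D a) - 2%:R * D a ^+ 2) - a ^+ 2 * b ^+ 2 * (a ^+ 2 - b ^+ 2).

(** As for the first equation: the defect T satisfies
    16 a^2 T(q^2) = (a + b)^2 T(q). If T starts with t_n q^n, comparison of the
    coefficients of q^n gives 4 t_n = 0 for n > 0, and 4 t_0 = 16 t_0. *)
Lemma second_order :
  4%:R * (a * D (D a) - 2%:R * D a ^+ 2) = a ^+ 2 * b ^+ 2 * (a ^+ 2 - b ^+ 2).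
Proof.
pose T := second_order_defect; suff : T = 0 by move/eqP; rewrite subr_eq0 => /eqP.
have recurrence : 16%:R * a ^+ 2 * sqvar T = (a + b) ^+ 2 * T.
  have eA : 2%:R * sqvar a = a + b := dupl_sum.
  have eB : sqvar b ^+ 2 = a * b by rewrite dupl_prod aE bE; ring.
  have eA' : 4%:R * sqvar (D a) = D a + D b.
    transitivity (D (2%:R * sqvar a)); last by rewrite eA raddfD.
    by rewrite DM Dnat D_sqvar; ring.
  have eA'' : 8%:R * sqvar (D (D a)) = D (D a) + D (D b).
    transitivity (D (4%:R * sqvar (D a))); last by rewrite eA' raddfD.
    by rewrite DM Dnat D_sqvar; ring.
  have -> : sqvar T = 4%:R * (sqvar a * sqvar (D (D a)) - 2%:R * sqvar (D a) ^+ 2)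
      - sqvar a ^+ 2 * sqvar b ^+ 2 * (sqvar a ^+ 2 - sqvar b ^+ 2).
    by rewrite /T /second_order_defect !(rmorphB, rmorphM, rmorphXn, rmorph_nat).
  rewrite eB.
  transitivity (a ^+ 2 * (4%:R * (2%:R * sqvar a) * (8%:R * sqvar (D (D a)))
     - 8%:R * (4%:R * sqvar (D a)) ^+ 2
     - (2%:R * sqvar a) ^+ 4 * (a * b) + 4%:R * (2%:R * sqvar a) ^+ 2 * (a * b) ^+ 2));
    first by ring.
  rewrite eA eA' eA''.
  (* With the logarithmic derivatives L of a and B of b, the previous lemma
     becomes the polynomial relation eW, modulo which both sides agree. *)
  pose L := finv a * D a; pose B := finv b * D b.
  have eDa : D a = a * L by rewrite mulrA mul_finv ?mul1r ?a_0.
  have eDb : D b = b * B by rewrite mulrA mul_finv ?mul1r ?b_0.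
  clearbody L B.
  have eW : a ^+ 2 = b ^+ 2 + 2%:R * L - 2%:R * B.
    have e : a * b * (2%:R * (L - B)) = a * b * (a ^+ 2 - b ^+ 2).
      by rewrite -wronskian eDa eDb; ring.
    have ab0 : cf (a * b) 0 = 1 by rewrite cfM0 a_0 b_0.
    have inv : finv (a * b) * (a * b) = 1 by rewrite mulrC mul_finv.
    have {}e : 2%:R * (L - B) = a ^+ 2 - b ^+ 2.
      transitivity (finv (a * b) * (a * b * (2%:R * (L - B)))).
        by rewrite mulrA inv mul1r.
      by rewrite e mulrA inv mul1r.
    by transitivity (b ^+ 2 + (a ^+ 2 - b ^+ 2)); [ring | rewrite -e; ring].
  have eL : D L = D B + a ^+ 2 * L - b ^+ 2 * B.
    apply: (@natmul_inj 2) => //; transitivity (D (b ^+ 2 + 2%:R * L - 2%:R * B)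
        - D (b ^+ 2) + 2%:R * D B).
      by rewrite raddfB raddfD /= !(DM, Dnat); ring.
    by rewrite -eW (DX a 1) (DX b 1) eDa eDb; ring.
  by rewrite /T /second_order_defect eDa eDb (DM a L) (DM b B) eDa eDb eL; ring: eW.
have van n : vanish n T.
  elim: n => [//|n IH] i; rewrite ltnS leq_eqVlt => /orP[/eqP ->|/IH //].
  have low : cf ((a + b) ^+ 2 * T) n = 4 * cf T n.
    by rewrite (cf_mul_low _ IH) cfX0 cfD a_0 b_0.
  have high : cf (a ^+ 2 * sqvar T) n = cf (sqvar T) n.
    rewrite cf_mul_low ?cfX0 ?a_0 ?mul1r //.
    by apply: vanish_le (vanish_sqvar IH); lia.
  have := congr1 (fun f => cf f n) recurrence.
  rewrite -[X in X = _]/(cf _ n) -[X in _ = X]/(cf _ n) -mulrA cf_natmul low high.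
  case: n IH {low high} => [|n] IH; first by have := cf_sqvar_double T 0; rewrite double0 => ->; move: (cf T 0) => x; lia.
  have lt_n : (n.+1 < n.+1.*2)%N by lia.
  by rewrite (vanish_sqvar IH lt_n); move: (cf T n.+1) => x; lia.
by apply: fpsP => n; apply: (van n.+1).
Qed.

(** ** The modular parameter *)

Definition evn : fps int := Fps (fun n => if odd n then 0 else (nsqrt n)%:Z).
Definition odn : fps int := Fps (fun n => if odd n then (nsqrt n)./2%:Z else 0).

Lemma theta_parts : theta = evn + 2%:R * odn /\ theta4 = evn - 2%:R * odn.
Proof.
have half n : odd n -> (nsqrt n)%:Z = 2%:R * (nsqrt n)./2%:Z.
  case: n => // n _; rewrite nsqrt_pos // mul2n doubleK -mul2n; lia.
split; apply: fpsP => n.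
  by rewrite cfD cf_natmul /=; case: ifP => [/half ->|_]; ring.
rewrite cfB cf_natmul cf_negvar -signr_odd /=.
by case: ifP => [/half ->|_]; rewrite ?expr1 ?expr0; ring.
Qed.

(** The quotient of a^2 - b^2 by 16, expressed by the even and odd parts of theta
    so that it visibly has integer coefficients. *)
Definition c : fps int := evn * odn * (evn ^+ 2 + 4%:R * odn ^+ 2).

Lemma a2_sub_b2 : a ^+ 2 - b ^+ 2 = 16%:R * c.
Proof. by rewrite aE bE /c; have [-> ->] := theta_parts; ring. Qed.

Definition u : fps int := finv a.
Lemma au : a * u = 1. Proof. exact: mul_finv a_0. Qed.

(** kappa is lambda / 16 for the modular lambda function, and ell is the quotient
    of the quasi-modular form D a / a by a^2. *)
Definition kappa : fps int := c * u ^+ 2.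
Definition ell : fps int := D a * u ^+ 3.

Lemma c_0 : cf c 0 = 0. Proof. by rewrite !cfM0 mulr0 mul0r. Qed.
Lemma c_1 : cf c 1 = 1.
Proof.
have [E0 O0 O1] : [/\ cf evn 0 = 1, cf odn 0 = 0 & cf odn 1 = 1] by [].
have EO0 : cf (evn * odn) 0 = 0 by rewrite cfM0 O0 mulr0.
have EO1 : cf (evn * odn) 1 = 1 by rewrite cfM1 O0 O1 E0.
have S0 : cf (evn ^+ 2 + 4%:R * odn ^+ 2) 0 = 1.
  by rewrite cfD cf_natmul (cfX0 evn) (cfX0 odn) E0 O0.
by rewrite /c cfM1 EO0 EO1 S0 mul0r add0r mulr1.
Qed.

Lemma kappa_0 : cf kappa 0 = 0. Proof. by rewrite cfM0 c_0 mul0r. Qed.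
Lemma kappa_1 : cf kappa 1 = 1.
Proof. by rewrite /kappa cfM1 c_0 c_1 mul0r add0r cfX0 cf_finv0. Qed.

Lemma D_a : D a = a ^+ 3 * ell.
Proof.
rewrite /ell; transitivity ((a * u) ^+ 3 * D a); last by ring.
by rewrite au expr1n mul1r.
Qed.

Lemma a2_kappa : a ^+ 2 * kappa = c.
Proof.
rewrite /kappa; transitivity ((a * u) ^+ 2 * c); first by ring.
by rewrite au expr1n mul1r.
Qed.

Lemma b2_kappa : b ^+ 2 = a ^+ 2 * (1 - 16%:R * kappa).
Proof.
transitivity (a ^+ 2 - 16%:R * (a ^+ 2 * kappa)); last by ring.
by rewrite a2_kappa -a2_sub_b2; ring.
Qed.

Lemma a_inj (f g : fps int) : a * f = a * g -> f = g.
Proof.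
have ua : u * a = 1 by rewrite mulrC au.
by move=> /(congr1 ( *%R u)); rewrite (mulrA u a f) (mulrA u a g) ua !mul1r.
Qed.

Lemma D_kappa : D kappa = kappa * (1 - 16%:R * kappa) * a ^+ 2.
Proof.
apply: (@natmul_inj 16) => //; apply/a_inj/a_inj.
have eDb2 : D (b ^+ 2) = b ^+ 2 * (2%:R * a ^+ 2 * ell) - b ^+ 2 * (a ^+ 2 - b ^+ 2).
  apply/a_inj; rewrite (DX b 1); transitivity (b * (2%:R * (b * D a) - 2%:R * (b * D a - a * D b))).
    by ring.
  by rewrite wronskian D_a; ring.
have : D (a ^+ 2 * (1 - 16%:R * kappa)) = D (b ^+ 2) by rewrite b2_kappa.
rewrite DM (DX a 1) raddfB /= D1 DM Dnat D_a eDb2 b2_kappa => e.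
transitivity (2%:R * a ^+ 4 * ell * (1 - 16%:R * kappa) - (2%:R * a ^+ 1 * (a ^+ 3 * ell) * (1 - 16%:R * kappa) +
    a ^+ 2 * (0 - (0 * kappa + 16%:R * D kappa)))); first by ring.
by rewrite e; ring.
Qed.

Lemma D_ell : D ell = a ^+ 2 * (4%:R * kappa * (1 - 16%:R * kappa) - ell ^+ 2).
Proof.
apply: (@natmul_inj 4) => //; do 4 apply: a_inj.
transitivity (4%:R * (a * D (D a) - 2%:R * D a ^+ 2) - 4%:R * a ^+ 6 * ell ^+ 2).
  by rewrite D_a DM (DX a 2) D_a; ring.
by rewrite second_order b2_kappa; ring.
Qed.

Lemma D_theta : 2%:R * D theta = theta * a ^+ 2 * ell.
Proof.
have th : theta * finv theta = 1 by exact: mul_finv theta_0.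
transitivity (theta * finv theta * (2%:R * D theta)); first by rewrite th mul1r.
transitivity (finv theta * D a); first by rewrite aE (DX theta 1); ring.
rewrite D_a [X in X * a ^+ 2]/(theta); transitivity ((theta * finv theta) * (theta * a ^+ 2 * ell)).
  by rewrite exprS {1}aE; ring.
by rewrite th mul1r.
Qed.

End ThetaSeries.

(** * Congruences at the cusp *)

Module Cusp.
Import HB.structures all_boot all_order all_algebra ring zify.
Import GRing.Theory.
Import Terms PowerSeries ThetaSeries.
Set Implicit Arguments. Unset Strict Implicit. Unset Printing Implicit Defensive.
Local Open Scope ring_scope.

Section Congruences.
Variable R : comNzRingType.
Implicit Types f g h : R.

Definition cong (m : nat) f g := exists h, f = g + m%:R * h.

Lemma cong_refl m f : cong m f f.
Proof. by exists 0; rewrite mulr0 addr0. Qed.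
Lemma cong_sym m f g : cong m f g -> cong m g f.
Proof. by case=> h ->; exists (- h); ring. Qed.
Lemma cong_trans m g f h : cong m f g -> cong m g h -> cong m f h.
Proof. by case=> x -> [y ->]; exists (x + y); ring. Qed.
Lemma congD m f f' g g' : cong m f g -> cong m f' g' -> cong m (f + f') (g + g').
Proof. by case=> x -> [y ->]; exists (x + y); ring. Qed.
Lemma congN m f g : cong m f g -> cong m (- f) (- g).
Proof. by case=> x ->; exists (- x); ring. Qed.
Lemma congM m f f' g g' : cong m f g -> cong m f' g' -> cong m (f * f') (g * g').
Proof.
by case=> x -> [y ->]; exists (g * y + x * g' + m%:R * x * y); ring.
Qed.
Lemma congMl m h f g : cong m f g -> cong m (h * f) (h * g).
Proof. exact/congM/cong_refl. Qed.
Lemma congMr m h f g : cong m f g -> cong m (f * h) (g * h).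
Proof. by move=> c; apply: congM c (cong_refl _ _). Qed.
Lemma congX m k f g : cong m f g -> cong m (f ^+ k) (g ^+ k).
Proof.
move=> c; elim: k => [|k IH]; first exact: cong_refl.
by rewrite !exprS; apply: congM.
Qed.
Lemma cong_sum m I (r : seq I) (P : pred I) (F G : I -> R) :
  (forall i, P i -> cong m (F i) (G i)) ->
  cong m (\sum_(i <- r | P i) F i) (\sum_(i <- r | P i) G i).
Proof.
by move=> c; apply: (big_ind2 (cong m)) => //; [exact: cong_refl | move=> *; exact: congD].
Qed.
Lemma cong_dvd m n f g : (m %| n)%N -> cong n f g -> cong m f g.
Proof. by case/dvdnP=> k -> [h ->]; exists (k%:R * h); rewrite natrM; ring. Qed.
Lemma cong_sub0 m f g : cong m (f - g) 0 <-> cong m f g.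
Proof.
by split=> -[h e]; exists h; [rewrite -[f](subrK g) e | rewrite e]; ring.
Qed.
Lemma cong_nat0 m k h : (m %| k)%N -> cong m (k%:R * h) 0.
Proof. by case/dvdnP=> j ->; exists (j%:R * h); rewrite natrM; ring. Qed.

(** In f^p - g^p = (f - g) (f^(p-1) + ... + g^(p-1)) the second factor is
    p g^(p-1) modulo p, which supplies the extra factor p. *)
Lemma cong_expp p k f g : (0 < k)%N ->
  cong (p ^ k) f g -> cong (p ^ k.+1) (f ^+ p) (g ^+ p).
Proof.
move=> k_gt0 c; have [x e] := c.
have c1 : cong p f g by apply: cong_dvd c; apply: dvdn_exp.
have [y e2] : cong p (\sum_(i < p) f ^+ (p.-1 - i) * g ^+ i) 0.
  have: cong p (\sum_(i < p) f ^+ (p.-1 - i) * g ^+ i) (\sum_(i < p) g ^+ p.-1).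
    apply: cong_sum => i _; rewrite -[in X in cong _ _ X](subnK (n := p.-1) (m := i)).
      by rewrite exprD; apply/congMr/congX.
    by have := ltn_ord i; lia.
  move/cong_trans; apply; rewrite sumr_const card_ord -mulr_natl.
  exact: cong_nat0.
exists (x * y); rewrite -[LHS](subrK (g ^+ p)) subrXX.
by rewrite e2 e expnSr natrM; ring.
Qed.

Lemma cong_exppX p k f g : cong p f g -> cong (p ^ k.+1) (f ^+ (p ^ k)) (g ^+ (p ^ k)).
Proof.
move=> c; elim: k => [|k IH]; first by rewrite expn0 !expr1 expn1.
have -> : (p ^ k.+1 = p ^ k * p)%N by rewrite expnSr.
by rewrite !exprM; apply: cong_expp.
Qed.

Lemma cong_frob p f g : prime p -> cong p ((f + g) ^+ p) (f ^+ p + g ^+ p).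
Proof.
move=> pr_p; rewrite exprDn; case: p pr_p => // p pr_p.
rewrite big_ord_recl big_ord_recr /= subn0 expr0 mulr1 bin0 mulr1n.
rewrite subnn expr0 mul1r binn mulr1n addrA addrAC.
rewrite -[X in cong _ _ X]addr0; apply: congD; first exact: cong_refl.
apply: (big_ind (fun x => cong p.+1 x 0)) => [|x y cx cy|i _].
- exact: cong_refl.
- by rewrite -[0]addr0; apply: congD.
- rewrite -mulr_natl; apply: cong_nat0.
  by apply: prime_dvd_bin => //=; rewrite /bump /= add1n ltnS ltn_ord.
Qed.

End Congruences.

Lemma cong_morph (R S : comNzRingType) (phi : {rmorphism R -> S}) m f g :
  cong m f g -> cong m (phi f) (phi g).
Proof. by case=> h ->; exists (phi h); rewrite rmorphD rmorphM rmorph_nat. Qed.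

Lemma cong_intP m (x y : int) : cong m x y <-> (m%:Z %| x - y)%Z.
Proof.
split=> [[h ->]|/dvdzP[q e]]; last by exists q; rewrite natz mulrC -e; ring.
by apply/dvdzP; exists h; rewrite natz; ring.
Qed.

Lemma cong_fpsP m (f g : fps int) :
  cong m f g <-> forall i, (m%:Z %| cf f i - cf g i)%Z.
Proof.
split=> [[h ->] i|dv].
  by rewrite cfD cf_natmul addrC addKr natz dvdz_mulr.
exists (Fps (fun i => (cf f i - cf g i) %/ m%:Z)%Z); apply: fpsP => i.
by rewrite cfD cf_natmul /= natz mulrC divzK //; ring.
Qed.

Lemma cong_polyP m (f g : {poly int}) :
  cong m f g <-> forall i, (m%:Z %| f`_i - g`_i)%Z.
Proof.
split=> [[h ->] i|dv].
  by rewrite coefD mulr_natl coefMn addrC addKr -mulr_natl natz dvdz_mulr.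
exists (\poly_(i < maxn (size f) (size g)) ((f`_i - g`_i) %/ m%:Z)%Z).
apply/polyP => i; rewrite coefD mulr_natl coefMn coef_poly.
case: ltnP => [_|]; first by rewrite -mulr_natl natz mulrC divzK //; ring.
by rewrite geq_max => /andP[sf sg]; rewrite !nth_default // mul0rn addr0.
Qed.

Lemma cong_fermat p (x : int) : prime p -> cong p (x ^+ p) x.
Proof.
move=> pr_p; have nat n : cong p (n%:R ^+ p) (n%:R : int).
  elim: n => [|n IH]; first by rewrite expr0n eqn0Ngt prime_gt0 //; apply: cong_refl.
  rewrite -natr1; apply: cong_trans (cong_frob _ _ pr_p) _.
  by apply: congD => //; rewrite expr1n; apply: cong_refl.
case: x => n; first by rewrite -[Posz n]natz; apply: nat.
rewrite NegzE -[n.+1%:Z]natz; move: (n.+1) => k.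
have := cong_frob (k%:R : int) (- k%:R) pr_p.
rewrite subrr expr0n eqn0Ngt prime_gt0 //= => z.
rewrite -[X in cong _ X _](addKr (k%:R ^+ p)) -[X in cong _ _ X]addr0.
by apply: congD (cong_sym z); apply: congN (nat k).
Qed.

(** ** The action of D on powers of theta and the polynomials P *)

Definition evr (R : comNzRingType) : R -> R -> tm -> R :=
  ev R +%R *%R (fun z => (ssrZ.int_of_Z z)%:~R).

Lemma evr_Kap (R : comNzRingType) (k l : R) :
  evr k l (dt Kap) = 2%:R * (k * (1 - 16%:R * k)).
Proof.
transitivity (2%:~R * (k * (1%:~R + (- 16)%:~R * k)) : R); first by [].
by rewrite !rmorphN /=; ring.
Qed.

Lemma evr_Ell (R : comNzRingType) (k l : R) :
  evr k l (dt Ell) = 8%:R * (k * (1 - 16%:R * k)) - 2%:R * (l * l).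
Proof.
transitivity (8%:~R * (k * (1%:~R + (- 16)%:~R * k)) + (- 2)%:~R * (l * l) : R); first by [].
by rewrite !rmorphN /=; ring.
Qed.

Lemma evr_Cst (R : comNzRingType) (k l : R) z :
  evr k l (Cst z) = (ssrZ.int_of_Z z)%:~R.
Proof. by []. Qed.
Lemma evr_Add (R : comNzRingType) (k l : R) s t :
  evr k l (Add s t) = evr k l s + evr k l t.
Proof. by []. Qed.
Lemma evr_Mul (R : comNzRingType) (k l : R) s t :
  evr k l (Mul s t) = evr k l s * evr k l t.
Proof. by []. Qed.

Lemma D_evr t : 2%:R * D (evr kappa ell t) = a ^+ 2 * evr kappa ell (dt t).
Proof.
elim: t => [||z|s IHs t IHt|s IHs t IHt].
- by rewrite evr_Kap [evr _ _ Kap]/= D_kappa; ring.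
- by rewrite evr_Ell [evr _ _ Ell]/= D_ell; ring.
- rewrite evr_Cst -[_%:~R](rmorph_int (@fpsC int)) DC.
  by rewrite [evr _ _ _]/(0%:~R) !mulr0.
- by rewrite !evr_Add raddfD /= mulrDr IHs IHt mulrDr.
- rewrite !(evr_Add, evr_Mul) DM.
  transitivity (2%:R * D (evr kappa ell s) * evr kappa ell t
    + evr kappa ell s * (2%:R * D (evr kappa ell t))); first by ring.
  by rewrite IHs IHt; ring.
Qed.

Definition D2 (f : fps int) := 2%:R * D f.

(** The factor theta a^(2 n) carries the weight; the remaining factor is a
    polynomial in kappa and ell that does not depend on q. *)
Lemma iter_D2_theta n :
  iter n D2 theta = theta * a ^+ (2 * n) * evr kappa ell (P n).
Proof.
elim: n => [|n IH]; first by rewrite muln0 expr0 mulr1 /evr /= mulr1.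
rewrite iterS IH /D2 DM DM.
rewrite (_ : D (a ^+ (2 * n)) = (2 * n)%:R * a ^+ (2 * n) * a ^+ 2 * ell); last first.
  case: n {IH} => [|n]; first by rewrite muln0 expr0 D1 !mul0r.
  by rewrite mulnS DX D_a !exprS; ring.
transitivity ((2%:R * D theta * a ^+ (2 * n)
     + 2%:R * theta * (2 * n)%:R * a ^+ (2 * n) * a ^+ 2 * ell)
   * evr kappa ell (P n)
   + theta * a ^+ (2 * n) * (2%:R * D (evr kappa ell (P n)))); first by ring.
rewrite D_theta D_evr [P n.+1]/= !(evr_Add, evr_Mul) evr_Cst.
have -> : ssrZ.int_of_Z (4 * Z.of_nat n + 1) = (4 * n + 1)%:Z by lia.
rewrite [evr _ _ Ell]/= mulnS exprD -[(4 * n + 1)%:Z]natz rmorph_nat.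
by rewrite natrD !natrM; ring.
Qed.

Lemma cf_iter_D2 n f i : cf (iter n D2 f) i = (2 * i)%:R ^+ n * cf f i.
Proof.
elim: n => [|n IH]; first by rewrite mul1r.
by rewrite iterS cf_natmul cf_D IH exprS natrM; ring.
Qed.

(** ** Polynomials in kappa *)

(** W y is D y / a^2 when y is a polynomial in kappa, and Hyp is the operator of
    the hypergeometric equation of F(1/2, 1/2; 1; 16 kappa). *)
Definition W (y : {poly int}) : {poly int} := 'X * (1 - 16%:R * 'X) * y^`().
Definition Hyp (y : {poly int}) : {poly int} := (W y)^`() - 4%:R * y.

Notation sub := (subst kappa).

Lemma D_sub y : D (sub y) = sub (W y) * a ^+ 2.
Proof.
rewrite D_subst D_kappa /W !substM [sub 'X]substX.
by rewrite rmorphB rmorphM rmorph1 rmorph_nat /= substX; ring.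
Qed.

Lemma D_sub_div y : D (sub y * u) = a * (sub (W y) - sub y * ell).
Proof.
have Du : D u = - (a * ell).
  apply: a_inj; transitivity (D (a * u) - u * D a); first by rewrite DM; ring.
  by rewrite au D1 D_a; transitivity (- (a ^+ 2 * ell * (a * u))); [|rewrite au]; ring.
rewrite DM D_sub Du; transitivity (sub (W y) * a * (a * u) - sub y * a * ell).
  by ring.
by rewrite au; ring.
Qed.

Lemma D2_sub_div y :
  D (D (sub y * u)) = a ^+ 3 * kappa * (1 - 16%:R * kappa) * sub (Hyp y).
Proof.
rewrite D_sub_div DM raddfB /= DM !D_sub D_ell D_a.
have -> : sub (Hyp y) = sub (W y)^`() - 4%:R * sub y.
  by rewrite rmorphB rmorphM rmorph_nat.
have -> : sub (W (W y)) = kappa * (1 - 16%:R * kappa) * sub (W y)^`().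
  rewrite [W (W y)]/W !substM [sub 'X]substX.
  by rewrite rmorphB rmorphM rmorph1 rmorph_nat /= substX.
ring.
Qed.

(** Let z be the series y(kappa) / a. If Hyp y vanishes modulo N^2, then N^2
    divides n^2 z_n for all n, hence also (n z_n)^2 = z_n n^2 z_n; so N divides
    the coefficients n z_n of D z. This makes ell the quotient W y / y modulo N. *)
Lemma unit_root N y : cong (N ^ 2) (Hyp y) 0 ->
  cong N (sub (W y)) (sub y * ell).
Proof.
move=> hyp; pose z := sub y * u.
have cDD : cong (N ^ 2) (D (D z)) 0.
  rewrite D2_sub_div -[X in cong _ _ X](mulr0 (a ^+ 3 * kappa * (1 - 16%:R * kappa))).
  by apply: congMl; rewrite -(rmorph0 (subst kappa)); apply: cong_morph.
have : cong N (D z) 0.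
  apply/cong_fpsP => i; move/cong_fpsP: cDD => /(_ i).
  rewrite !cf0 !subr0 cf_D => dv.
  have : ((N ^ 2)%:Z %| cf (D z) i ^+ 2)%Z.
    by rewrite expr2 {1}cf_D mulrAC; apply: dvdz_mulr.
  by rewrite !dvdzE abszX dvdn_pexp2r.
rewrite /z D_sub_div => /(congMl u); rewrite mulr0 mulrA [u * a]mulrC au mul1r.
by move/cong_sub0.
Qed.

(** kappa is a local parameter also over the integers modulo N. *)
Lemma sub_cong N f g : (1 < N)%N -> cong N (sub f) (sub g) -> cong N f g.
Proof.
move=> N_gt1 c; pose phi : {rmorphism int -> 'Z_N} := intr.
have phi0 (x : int) : phi x = 0 <-> (N%:Z %| x)%Z.
  have nat0 n : (n%:R = 0 :> 'Z_N) <-> (N %| n)%N.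
    by rewrite /dvdn -(val_Zp_nat N_gt1); split=> [->|/eqP e] //; apply/val_inj.
  rewrite dvdzE; case: x => n; first exact: nat0.
  have -> : phi (Negz n) = - n.+1%:R by rewrite /phi /= NegzE rmorphN.
  rewrite [absz _]/= -nat0; split=> [h|->]; last by rewrite oppr0.
  by rewrite -[LHS]opprK h oppr0.
have : map_poly phi (f - g) = 0.
  apply: (@subst_inj _ (fmap phi kappa)).
  - by rewrite -[LHS]/(phi (cf kappa 0)) kappa_0 rmorph0.
  - by rewrite -[LHS]/(phi (cf kappa 1)) kappa_1 rmorph1.
  rewrite -fmap_subst; apply: fpsP => i; apply/phi0.
  by rewrite rmorphB cfB; move/cong_fpsP: c; apply.
move=> e; apply/cong_polyP => i; apply/phi0.
by rewrite -coefB -coef_map e coef0.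
Qed.

(** If ell is w / y, a power of y turns any polynomial in kappa and ell into a
    polynomial Q in kappa alone. The same Q must serve for every ring, since it is
    used both at the cusp and at kappa = 1/32. *)
Lemma clear_denominator N (y w : {poly int}) t : exists K (Q : {poly int}),
  forall (B : comNzRingType) (f : {rmorphism {poly int} -> B}) (l : B),
    cong N (f y * l) (f w) -> cong N (f y ^+ K * evr (f 'X) l t) (f Q).
Proof.
elim: t => [||z|s [K1 [Q1 IH1]] t [K2 [Q2 IH2]]|s [K1 [Q1 IH1]] t [K2 [Q2 IH2]]].
- by exists 0, 'X => B f l c; rewrite mul1r; apply: cong_refl.
- by exists 1, w => B f l c; rewrite expr1.
- exists 0, (ssrZ.int_of_Z z)%:~R => B f l c.
  by rewrite mul1r evr_Cst rmorph_int; apply: cong_refl.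
- exists (K1 + K2)%N, (y ^+ K2 * Q1 + y ^+ K1 * Q2) => B f l c.
  rewrite evr_Add rmorphD !rmorphM !rmorphXn exprD mulrDr.
  apply: congD; last by rewrite -mulrA; exact: congMl (IH2 _ _ _ c).
  by rewrite [X in X * _]mulrC -mulrA; exact: congMl (IH1 _ _ _ c).
- exists (K1 + K2)%N, (Q1 * Q2) => B f l c.
  by rewrite evr_Mul rmorphM exprD mulrACA; apply: congM; [apply: IH1|apply: IH2].
Qed.

(** ** Truncated hypergeometric series *)

Definition cbin (n : nat) : int := ('C(2 * n, n))%:R.
Definition bb (n : nat) : int := cbin n ^+ 2.

Lemma cbinS n : n.+1%:R * cbin n.+1 = (2 * (2 * n + 1))%:R * cbin n :> int.
Proof.
rewrite /cbin -!natrM; congr _%:R.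
have e1 := mul_bin_diag (2 * n).+1.+1 n; have e2 := mul_bin_down (2 * n).+1 n.
rewrite /= in e1 e2; have -> : (2 * n.+1 = (2 * n).+2)%N by lia.
have e3 : ((2 * n).+1 - n = n.+1)%N by lia.
by rewrite e3 in e2; nia.
Qed.

Lemma bbS n : n.+1%:R ^+ 2 * bb n.+1 = 4%:R * (2 * n + 1)%:R ^+ 2 * bb n :> int.
Proof.
rewrite /bb; transitivity ((n.+1%:R * cbin n.+1) ^+ 2 : int); first by ring.
by rewrite cbinS natrM; ring.
Qed.

Definition yp N : {poly int} := \sum_(i < N) (bb i)%:P * 'X^i.

Lemma coef_yp N i : (yp N)`_i = if (i < N)%N then bb i else 0.
Proof.
have -> : yp N = \poly_(i < N) bb i.
  by rewrite poly_def; apply: eq_bigr => j _; rewrite mul_polyC.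
by rewrite coef_poly.
Qed.

Lemma coef_Hyp y i :
  (Hyp y)`_i = i.+1%:R ^+ 2 * y`_i.+1 - 4%:R * (2 * i + 1)%:R ^+ 2 * y`_i.
Proof.
have eX j : ('X * y^`())`_j = j%:R * y`_j.
  by case: j => [|j]; rewrite coefXM ?mul0r // coef_deriv /= mulr_natl.
have -> : Hyp y = ('X * y^`() - 16%:R * ('X * ('X * y^`())))^`() - 4%:R * y.
  by rewrite /Hyp /W; congr (_^`() - _); ring.
have eN k (f : {poly int}) j : (k%:R * f)`_j = k%:R * f`_j.
  by rewrite !mulr_natl coefMn.
rewrite coefB coef_deriv coefB !eN eX coefXM /= eX -[_ *+ i.+1]mulr_natl natrD natrM.
rewrite -[i.+1%:R]natr1.
move: (y`_i.+1) (y`_i) (i%:R) => s t x; ring.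
Qed.

(** The recurrence for the coefficients only fails at the cut. *)
Lemma Hyp_yp N : Hyp (yp N.+1) = (- (N.+1%:R ^+ 2 * bb N.+1))%:P * 'X^N.
Proof.
apply/polyP => i; rewrite coef_Hyp !coef_yp coefCM coefXn !ltnS.
case: (ltngtP i N) => [lt|gt|->]; rewrite ?mulr0 ?subrr //.
  by rewrite bbS subrr.
by rewrite sub0r bbS mulr1.
Qed.

Lemma Hyp_yp_cong N : (0 < N)%N -> cong (N ^ 2) (Hyp (yp N)) 0.
Proof.
case: N => // N _; rewrite Hyp_yp; exists (- (bb N.+1)%:P * 'X^N).
by rewrite polyCN polyCM natrX rmorphXn rmorph_nat /=; ring.
Qed.

(** The untruncated series at kappa is a: its quotient by a is killed by D^2,
    hence constant. *)
Lemma sub_yp N : vanish N (sub (yp N) - a).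
Proof.
case: N => [//|N]; pose z := sub (yp N.+1) * u.
have cz : vanish N.+1 (D (D z)).
  rewrite D2_sub_div Hyp_yp substM substC rmorphXn /= substX.
  move: (fpsC _) => x.
  have -> : a ^+ 3 * kappa * (1 - 16%:R * kappa) * (x * kappa ^+ N)
     = a ^+ 3 * (1 - 16%:R * kappa) * x * kappa ^+ N.+1.
    by rewrite [kappa ^+ N.+1]exprS; ring.
  rewrite -[N.+1]add0n; apply: vanishM => //; rewrite -[X in vanish X]mul1n.
  by apply: vanishX => -[] // _; exact: kappa_0.
have z1 : vanish N.+1 (z - 1).
  move=> [|i] lt_i.
    have u0 : cf u 0 = 1 := cf_finv0 a.
    rewrite cfB cfM0 (cf_subst0 _ kappa_0) coef_yp ltn0Sn u0 cf1.
    by rewrite /bb /cbin muln0 bin0 expr1n mulr1 subrr.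
  rewrite cfB cf1 subr0; have := cz _ lt_i; rewrite !cf_D => /eqP.
  by rewrite !mulf_eq0 !Num.Theory.pnatr_eq0 /= => /eqP.
have -> : sub (yp N.+1) - a = a * (z - 1).
  rewrite /z; transitivity (sub (yp N.+1) * (a * u) - a); last by ring.
  by rewrite au mulr1.
by rewrite -[N.+1]add0n; apply: vanishM.
Qed.

Lemma coef_expr1DX (R : comNzRingType) n k :
  ((1 + 'X) ^+ n : {poly R})`_k = 'C(n, k)%:R.
Proof.
elim: n k => [|n IH] k; first by rewrite expr0 coef1 bin0n eq_sym.
rewrite exprS mulrDl mul1r coefD coefXM !IH; case: k => [|k] /=.
  by rewrite !bin0 addr0.
by rewrite -natrD binS.
Qed.

(** Lucas: (1 + X)^(2 i + 2 p j) is (1 + X)^(2 i) (1 + X^p)^(2 j) modulo p. *)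
Lemma cbin_lucas p i j : prime p -> (i < p)%N ->
  cong p (cbin (i + p * j)) (cbin i * cbin j).
Proof.
move=> pr_p lt_ip.
have c : cong p ((1 + 'X) ^+ (2 * (i + p * j)) : {poly int})
      ((1 + 'X) ^+ (2 * i) * (1 + 'X^p) ^+ (2 * j)).
  have -> : (2 * (i + p * j) = 2 * i + p * (2 * j))%N by rewrite mulnDr mulnCA.
  rewrite exprD [(1 + 'X) ^+ (p * _)]exprM; apply/congMl/congX.
  by have := cong_frob (1 : {poly int}) 'X pr_p; rewrite expr1n.
move/cong_polyP: c => /(_ (i + p * j)%N); rewrite coef_expr1DX.
suff -> : ((1 + 'X) ^+ (2 * i) * (1 + 'X^p) ^+ (2 * j) : {poly int})`_(i + p * j)
    = cbin i * cbin j by move/cong_intP.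
rewrite [(1 + 'X^p) ^+ _]exprDn mulr_sumr coef_sum.
have lt_j : (j < (2 * j).+1)%N by lia.
have term (k : nat) : ((1 + 'X) ^+ (2 * i) * (1 ^+ (2 * j - k) * 'X^p ^+ k *+ 'C(2 * j, k)) : {poly int})`_(i + p * j)
   = if (i + p * j < p * k)%N then 0 else 'C(2 * i, i + p * j - p * k)%:R * 'C(2 * j, k)%:R.
  rewrite expr1n mul1r -exprM mulrnAr coefMn coefMXn coef_expr1DX.
  by case: ifP => _; rewrite ?mul0rn // mulr_natr.
rewrite (bigD1 (Ordinal lt_j)) // term big1 => [|k ne_kj].
  by rewrite Monoid.mulm1 ltnNge leq_addl /= addnK.
rewrite term; case: ltnP => // le_k; rewrite bin_small ?mul0r //.
have lt_kj : (k < j)%N.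
  case: (ltngtP k j) => // [lt_jk|e].
    have : (p * j.+1 <= p * k)%N by rewrite leq_pmul2l ?prime_gt0.
    by rewrite mulnS; lia.
  by rewrite -val_eqE /= e eqxx in ne_kj.
have : (p * k.+1 <= p * j)%N by rewrite leq_pmul2l ?prime_gt0.
by rewrite mulnS; lia.
Qed.

(** The coefficients satisfy bb (i + p j) = bb i bb j^p modulo p, by Lucas and
    Fermat. *)
Lemma yp_frob p M : prime p -> cong p (yp (p * M)) (yp p * yp M ^+ p).
Proof.
move=> pr_p; elim: M => [|M IH].
  by rewrite muln0 /yp !big_ord0 expr0n eqn0Ngt prime_gt0 // mulr0; apply: cong_refl.
have -> : yp (p * M.+1) = yp (p * M)
    + \sum_(i < p) (bb (p * M + i))%:P * 'X^(p * M + i).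
  by rewrite /yp mulnS addnC big_split_ord.
apply: (@cong_trans _ _ (yp p * (yp M ^+ p + ((bb M)%:P * 'X^M) ^+ p))); last first.
  apply/congMl/cong_sym; rewrite {1}/yp big_ord_recr; exact: cong_frob.
rewrite mulrDr; apply: congD => //; rewrite {1}/yp mulr_suml.
apply: cong_sum => i _; rewrite exprD.
have c : cong p (bb (p * M + i)) (bb i * bb M ^+ p).
  apply: (@cong_trans _ _ (bb i * bb M)); last exact/congMl/cong_sym/cong_fermat.
  by rewrite /bb -exprMn addnC; apply/congX/cbin_lucas.
have {}c : cong p (bb (p * M + i))%:P (bb i * bb M ^+ p)%:P by apply: cong_morph.
have -> : (bb i)%:P * 'X^i * ((bb M)%:P * 'X^M) ^+ p
    = (bb i * bb M ^+ p)%:P * ('X^(p * M) * 'X^i).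
  rewrite exprMn -exprM [(M * p)%N]mulnC mulrACA ['X^i * _]mulrC.
  by rewrite -(rmorphXn (@polyC int)) -polyCM.
exact: congMr.
Qed.

(** In the limit M -> infinity, both truncations of length p M and M are a, and
    the previous congruence becomes a = y_p(kappa) a^p. *)
Lemma hasse p : prime p -> cong p (sub (yp p) * a ^+ p.-1) 1.
Proof.
move=> pr_p; have p_gt0 := prime_gt0 pr_p.
suff c : cong p a (sub (yp p) * a ^+ p).
  have -> : sub (yp p) * a ^+ p.-1 = sub (yp p) * a ^+ p * u.
    transitivity (sub (yp p) * a ^+ p.-1 * (a * u)); first by rewrite au mulr1.
    have -> : a ^+ p = a ^+ p.-1 * a by rewrite -exprSr prednK.
    ring.
  by rewrite -[X in cong _ _ X]au; apply/congMr/cong_sym.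
apply/cong_fpsP => i; pose M := i.+1.
have := cong_morph (subst kappa) (yp_frob M pr_p).
rewrite rmorphM rmorphXn => /cong_fpsP /(_ i).
have -> : cf (sub (yp (p * M))) i = cf a i.
  apply/eqP; rewrite -subr_eq0 -cfB sub_yp //.
  by rewrite (leq_trans (ltnSn i)) // leq_pmull.
suff -> : cf (sub (yp p) * sub (yp M) ^+ p) i = cf (sub (yp p) * a ^+ p) i by [].
apply/eqP; rewrite -subr_eq0 -cfB -mulrBr subrXX.
rewrite (_ : cf _ i = 0) //; apply: (@vanishM _ 0 M) => //.
by rewrite -{1}[M]addn0; apply: vanishM => //; apply: sub_yp.
Qed.

Lemma W_comp_sym h y : W (y \Po ((2%:R * h)%:P - 'X)) =
   - (W y \Po ((2%:R * h)%:P - 'X))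
   + ('X * (1 - 16%:R * 'X)
        - (('X * (1 - 16%:R * 'X)) \Po ((2%:R * h)%:P - 'X)))
     * (y \Po ((2%:R * h)%:P - 'X))^`().
Proof.
rewrite /W deriv_comp derivB derivC derivX sub0r [(_ * y^`()) \Po _]comp_polyM.
set s := _ - 'X; move: (y^`() \Po s) (('X * (1 - 16%:R * 'X)) \Po s).
move: ('X * (1 - 16%:R * 'X)) => A B C; ring.
Qed.

Lemma cong_deriv N (f g : {poly int}) : cong N f g -> cong N f^`() g^`().
Proof.
case=> x ->; exists x^`(); rewrite derivD; congr (_ + _).
by rewrite !mulr_natl derivMn.
Qed.

(** The equation is invariant under kappa -> 1/16 - kappa, which is
    X -> 2 h - X for an inverse h of 32. *)
Lemma Hyp_sym N h y : cong N (32%:R * h) 1 -> cong N (Hyp y) 0 ->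
  cong N (Hyp (y \Po ((2%:R * h)%:P - 'X))) 0.
Proof.
move=> [x ex] cy; pose s : {poly int} := (2%:R * h)%:P - 'X.
rewrite -/s; have cW : cong N (W (y \Po s)) (- (W y \Po s)).
  rewrite W_comp_sym -/s -[X in cong _ _ X]addr0; apply: congD; first exact: cong_refl.
  exists (- 2%:R * x%:P * ('X - h%:P) * (y \Po s)^`()).
  rewrite add0r mulrA; congr (_ * _).
  have e1 : 32%:R * h%:P = 1 + N%:R * x%:P :> {poly int}.
    by rewrite -(rmorph_nat (@polyC int) 32) -polyCM ex polyCD polyCM rmorph_nat.
  have -> : N%:R * (- 2%:R * x%:P * ('X - h%:P))
      = - 2%:R * (32%:R * h%:P - 1) * ('X - h%:P) :> {poly int}.
    by rewrite e1; ring.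
  have -> : ('X * (1 - 16%:R * 'X)) \Po s = s * (1 - 16%:R * s).
    by rewrite rmorphM rmorphB rmorphM rmorph1 rmorph_nat /= comp_polyX.
  by rewrite /s polyCM rmorph_nat; ring.
have cH : cong N (Hyp (y \Po s)) (Hyp y \Po s).
  rewrite /Hyp rmorphB; apply: congD.
    apply: cong_trans (cong_deriv cW) _.
    rewrite derivN deriv_comp /s derivB derivC derivX sub0r mulrN1 opprK.
    exact: cong_refl.
  by rewrite rmorphM rmorph_nat; apply: cong_refl.
by apply: cong_trans cH _; rewrite -(rmorph0 (comp_poly s)); apply: cong_morph.
Qed.

Notation at_ h := (horner_eval (h : int)).

Lemma at_X h : at_ h 'X = h. Proof. exact: hornerX. Qed.

Lemma at_M h f g : at_ h (f * g) = at_ h f * at_ h g.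
Proof. exact: hornerM. Qed.

Lemma at_W h f : at_ h (W f) = h * (1 - 16%:R * h) * f^`().[h].
Proof.
rewrite /W !at_M at_X; congr (_ * _ * _).
by rewrite rmorphB rmorphM rmorph1 rmorph_nat /= [horner_eval _ _]at_X.
Qed.

(** Modulo p, y_(p^(e+1)) is y_p times the p-th power of y_(p^e). *)
Lemma yp_unit p h e : prime p -> ~~ (p%:Z %| at_ h (yp p))%Z ->
  ~~ (p%:Z %| at_ h (yp (p ^ e)))%Z.
Proof.
move=> pr_p unit_p; elim: e => [|e IH].
  rewrite expn0 /yp big_ord1 expr0 mulr1 /horner_eval hornerC.
  by rewrite /bb /cbin muln0 bin0 expr1n dvdzE dvdn1 neq_ltn prime_gt1 ?orbT.
have := cong_morph (at_ h) (yp_frob (p ^ e) pr_p).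
rewrite -expnS rmorphM rmorphXn => /cong_intP dv.
apply/negP => dv2; have : (p%:Z %| at_ h (yp p) * at_ h (yp (p ^ e)) ^+ p)%Z.
  by rewrite -[X in (_ %| X)%Z](subKr (at_ h (yp (p ^ e.+1)))); apply: rpredB.
rewrite dvdzE abszM abszX Euclid_dvdM // Euclid_dvdX // => /orP[d|/andP[d _]].
  by move: unit_p; rewrite dvdzE d.
by move: IH; rewrite dvdzE d.
Qed.

(** At 1/32, the fixed point of kappa -> 1/16 - kappa, the two solutions y and
    y(1/16 - kappa) have equal values and opposite derivatives. Both determine
    the same ell, so 2 y W y vanishes there. *)
Lemma W_yp_center p e h : prime p -> (2 < p)%N ->
  cong ((p ^ e) ^ 2) (32%:R * h) 1 -> ~~ (p%:Z %| at_ h (yp p))%Z ->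
  cong (p ^ e) (at_ h (W (yp (p ^ e)))) 0.
Proof.
move=> pr_p p_gt2 ch unit_p; set N := (p ^ e)%N.
have N_gt0 : (0 < N)%N by rewrite expn_gt0 prime_gt0.
case: e @N N_gt0 ch => [|e] N N_gt0 ch.
  by exists (at_ h (W (yp N))); rewrite add0r mul1r.
have N_gt1 : (1 < N)%N by rewrite -(exp1n e.+1) ltn_exp2r // prime_gt1.
pose y := yp N; pose y' := y \Po ((2%:R * h)%:P - 'X).
have Hy : cong (N ^ 2) (Hyp y) 0.
  exact: Hyp_yp_cong.
have cy := unit_root Hy; have cy' := unit_root (Hyp_sym ch Hy).
have c : cong N (W y * y') (W y' * y).
  apply: sub_cong => //; rewrite (substM _ (W y)) (substM _ (W y')).
  apply: (@cong_trans _ _ (sub y * ell * sub y')); first exact: congMr.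
  apply: cong_sym; have -> : sub y * ell * sub y' = sub y' * ell * sub y by ring.
  exact: congMr.
have : cong N (at_ h (W y) * at_ h y') (at_ h (W y') * at_ h y).
  by rewrite -!at_M; apply: (cong_morph (at_ h) c).
have -> : at_ h y' = at_ h y.
  rewrite /y' /horner_eval horner_comp !hornerE; congr horner; ring.
have -> : at_ h (W y') = - at_ h (W y).
  rewrite !at_W /y' deriv_comp derivB derivC derivX sub0r.
  rewrite hornerM horner_comp hornerN hornerD hornerN !hornerC hornerX.
  have -> : 2%:R * h - h = h by ring.
  ring.
move/cong_intP; rewrite (_ : _ - _ = 2%:R * at_ h y * at_ h (W y)); last by ring.
rewrite dvdzE abszM Gauss_dvdr => [dv|].
  by apply/cong_intP; rewrite subr0 dvdzE.
rewrite /N; apply: coprimeXl; rewrite prime_coprime // abszM Euclid_dvdM //.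
rewrite negb_or; apply/andP; split; last exact: yp_unit.
by apply/negP => /dvdn_leq -/(_ isT); rewrite leqNgt p_gt2.
Qed.

(** Multiples of p cause no exception, since both powers then vanish modulo p^e. *)
Lemma cong_euler p e n x : prime p -> (e <= n)%N ->
  cong (p ^ e) (x%:R ^+ (n + p ^ e.-1 * p.-1) : int) (x%:R ^+ n).
Proof.
move=> pr_p le_en; case: e le_en => [|e] le_en.
  by rewrite expn0; exists (x%:R ^+ (n + p ^ 0.-1 * p.-1) - x%:R ^+ n); rewrite mul1r; ring.
have [/dvdnP[y ->]|ndiv] := boolP (p %| x)%N.
  have zero m : (e.+1 <= m)%N -> cong (p ^ e.+1) ((y * p)%:R ^+ m : int) 0.
    move=> le_em; rewrite natrM mulrC exprMn -(subnKC le_em) exprD -natrX -mulrA.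
    exact: cong_nat0.
  apply: cong_trans (zero _ _) (cong_sym (zero _ _)) => //.
  by apply: leq_trans le_en (leq_addr _ _).
rewrite exprD -[X in cong _ _ X]mulr1; apply: congMl.
have c1 : cong p (x%:R ^+ p.-1 : int) 1.
  have /cong_intP := cong_fermat (x%:R : int) pr_p.
  rewrite -{1}(prednK (prime_gt0 pr_p)) exprS -[X in _ - X]mulr1 -mulrBr.
  rewrite dvdzE abszM natz Gauss_dvdr; last by rewrite prime_coprime.
  by move=> dv; apply/cong_intP; rewrite dvdzE.
rewrite mulnC exprM -[X in cong _ _ X](expr1n _ (p ^ e)).
exact: cong_exppX.
Qed.

(** On coefficients, 2 D multiplies by 2 i, so Euler's theorem gives
    (2 D)^(n + phi) theta = (2 D)^n theta modulo p^e, that is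
    a^(2 phi) P_(n + phi) = P_n. Here a^(2 phi) is the inverse of
    y_p(kappa)^(2 p^(e-1)). After clearing the denominator of ell this is a
    congruence between polynomials in the local parameter kappa, which may be
    evaluated at 1/32, where ell vanishes. *)
Lemma P_cong p e n h : prime p -> (2 < p)%N -> (0 < e)%N -> (e <= n)%N ->
  cong ((p ^ e) ^ 2) (32%:R * h) 1 -> ~~ (p%:Z %| at_ h (yp p))%Z ->
  cong (p ^ e) (evr h 0 (P (n + p ^ e.-1 * p.-1)))
    (at_ h (yp p) ^+ (2 * p ^ e.-1) * evr h 0 (P n)).
Proof.
move=> pr_p p_gt2 e_gt0 le_en ch unit_p.
set phi := (p ^ e.-1 * p.-1)%N; set N := (p ^ e)%N; set H := yp p.
have N_gt1 : (1 < N)%N by rewrite -(exp1n e) ltn_exp2r // prime_gt1.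
have c1 : cong N (a ^+ (2 * phi) * evr kappa ell (P (n + phi))) (evr kappa ell (P n)).
  have : cong N (iter (n + phi) D2 theta) (iter n D2 theta).
    apply/cong_fpsP => i; rewrite !cf_iter_D2; apply/cong_intP/congMr.
    exact: cong_euler.
  move/(congMl (finv theta * u ^+ (2 * n))); rewrite !iter_D2_theta.
  have th : theta * finv theta = 1 by exact: mul_finv theta_0.
  have simp m x : finv theta * u ^+ (2 * n) * (theta * a ^+ (2 * n + m) * x) = a ^+ m * x.
    transitivity ((theta * finv theta) * (a * u) ^+ (2 * n) * a ^+ m * x).
      by rewrite exprMn exprD; ring.
    by rewrite th au expr1n !mul1r.
  have := simp 0%N (evr kappa ell (P n)); rewrite addn0 expr0 mul1r => ->.
  by rewrite mulnDr simp.
have c2 : cong N (sub H ^+ (2 * p ^ e.-1) * a ^+ (2 * phi)) 1.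
  have := cong_exppX e.-1 (hasse pr_p); rewrite prednK // expr1n => /(congX 2).
  rewrite expr1n; suff -> : sub H ^+ (2 * p ^ e.-1) * a ^+ (2 * phi)
    = ((sub (yp p) * a ^+ p.-1) ^+ (p ^ e.-1)) ^+ 2 by [].
  rewrite -exprM exprMn -exprM; congr (_ ^+ _ * _ ^+ _); first exact: mulnC.
  by rewrite /phi mulnC mulnAC mulnC.
have c : cong N (evr kappa ell (P (n + phi)))
    (sub (H ^+ (2 * p ^ e.-1)) * evr kappa ell (P n)).
  apply: cong_trans (congMl _ c1); rewrite rmorphXn mulrA.
  rewrite -[X in cong _ X _]mul1r; exact/congMr/cong_sym.
have [K1 [Q1 clear1]] := clear_denominator N (yp N) (W (yp N)) (P (n + phi)).
have [K2 [Q2 clear2]] := clear_denominator N (yp N) (W (yp N)) (P n).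
have ck : cong N (sub (yp N) * ell) (sub (W (yp N))).
  apply: cong_sym; have N_gt0 : (0 < N)%N by exact: ltnW.
  exact/unit_root/Hyp_yp_cong.
have cQ : cong N (yp N ^+ K2 * Q1) (yp N ^+ K1 * H ^+ (2 * p ^ e.-1) * Q2).
  apply: sub_cong => //; rewrite !substM !(rmorphXn (subst kappa) K1, rmorphXn (subst kappa) K2).
  have := clear1 _ (subst kappa) ell ck; have := clear2 _ (subst kappa) ell ck.
  rewrite ![_ 'X]substX => k2 k1.
  apply: (@cong_trans _ _ (sub (yp N) ^+ K2 * (sub (yp N) ^+ K1 * evr kappa ell (P (n + phi))))).
    exact/congMl/cong_sym.
  apply: (@cong_trans _ _ (sub (yp N) ^+ K1 * sub (H ^+ (2 * p ^ e.-1)) * (sub (yp N) ^+ K2 * evr kappa ell (P n)))).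
    rewrite mulrCA -!mulrA; apply: congMl; rewrite mulrCA; apply: congMl.
    exact: c.
  exact: congMl.
have c0 : cong N (at_ h (yp N) * 0) (at_ h (W (yp N))).
  by rewrite mulr0; apply/cong_sym/W_yp_center.
have := cong_morph (at_ h) cQ; rewrite !rmorphM !rmorphXn /= => cE.
have := clear1 _ (at_ h) 0 c0; have := clear2 _ (at_ h) 0 c0.
rewrite ![_ 'X]at_X => k2 k1.
set x := evr h 0 _ in k1 *; set x' := evr h 0 _ in k2 *.
set yh := at_ h (yp N) in k1 k2 cE *; set Hh := at_ h H in cE *.
have {cE} : cong N (yh ^+ (K1 + K2) * x) (yh ^+ (K1 + K2) * (Hh ^+ (2 * p ^ e.-1) * x')).
  apply: (@cong_trans _ _ (yh ^+ K2 * at_ h Q1)).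
    by rewrite exprD [yh ^+ K1 * _]mulrC -mulrA; apply: congMl.
  apply: cong_trans cE _.
  rewrite exprD -!mulrA; apply: congMl; rewrite [yh ^+ K2 * _]mulrCA; apply: congMl.
  exact: cong_sym.
move/cong_intP; rewrite -mulrBr dvdzE abszM Gauss_dvdr => [dv|].
  by apply/cong_intP; rewrite dvdzE.
rewrite /N; apply: coprimeXl; rewrite prime_coprime // abszX.
apply/negP; rewrite Euclid_dvdX // => /andP[dv _].
by have := yp_unit e pr_p unit_p; rewrite dvdzE dv.
Qed.

End Cusp.

(** * The constant modulo p *)

Module Constants.
Import HB.structures all_boot all_order all_algebra ring zify.
Import GRing.Theory.
Import Terms PowerSeries ThetaSeries Cusp.
Set Implicit Arguments. Unset Strict Implicit. Unset Printing Implicit Defensive.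
Local Open Scope ring_scope.

Section PrimeField.
Variables (p r : nat).
Hypothesis pr_p : prime p.
Hypothesis p_eq : p = (4 * r + 1)%N.
Notation F := 'F_p.
Let m := (2 * r)%N.

Lemma charF : p \in [pchar F]. Proof. exact: pchar_Fp. Qed.

Lemma p_eq0 : p%:R = 0 :> F. Proof. exact: pcharf0 charF. Qed.

Lemma nat_neq0 k : (0 < k < p)%N -> k%:R != 0 :> F.
Proof. by case/andP=> k0 kp; rewrite -(dvdn_pcharf charF) gtnNdvd. Qed.

Lemma natF k l x y : (k + p * x = l + p * y)%N -> k%:R = l%:R :> F.
Proof.
by move/(congr1 (fun n => n%:R : F)); rewrite !natrD !natrM p_eq0 !mul0r !addr0.
Qed.

Lemma four_r : 4%:R * r%:R + 1 = 0 :> F.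
Proof. by rewrite -natrM natr1 -p_eq0 p_eq addn1. Qed.

(** Wilson's theorem with the last l factors p - i of (p - 1)! replaced by - i. *)
Lemma wilson_split k l : (k + l = p.-1)%N ->
  (k`!)%:R * (l`!)%:R * (-1) ^+ l = -1 :> F.
Proof.
elim: l k => [|l IH] k e.
  have /eqP : ((p.-1)`!).+1%:R == 0 :> F.
    by rewrite -(dvdn_pcharf charF) -Wilson // prime_gt1.
  by rewrite -natr1 -e addn0 fact0 !mulr1 => /eqP; rewrite addr_eq0 => /eqP.
transitivity ((k.+1`!)%:R * (l`!)%:R * (-1) ^+ l : F); last by apply: IH; lia.
have ek : k.+1%:R + l.+1%:R = 0 :> F.
  by rewrite -natrD -[RHS]p_eq0; congr _%:R; have := prime_gt0 pr_p; lia.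
rewrite !factS !natrM exprS; move/eqP: ek; rewrite addr_eq0 => /eqP ->.
ring.
Qed.

(** The central binomial coefficient is (-4)^i times (-1/2 choose i), and -1/2 is
    m = (p - 1) / 2 modulo p. *)
Lemma cbin_mod i : (i < p)%N ->
  'C(2 * i, i)%:R = (- 4%:R) ^+ i * 'C(m, i)%:R :> F
  /\ 'C(2 * i, i)%:R = 4%:R ^+ i * 'C(m + i, i)%:R :> F.
Proof.
elim: i => [|i IH] lt_ip; first by rewrite muln0 !bin0 !expr0 mul1r.
have [IH1 IH2] := IH (ltnW lt_ip).
have i1 : i.+1%:R != 0 :> F by apply: nat_neq0.
have ecb : i.+1%:R * 'C(2 * i.+1, i.+1)%:R = (2%:R * (2%:R * i%:R + 1)) * 'C(2 * i, i)%:R :> F.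
  have := congr1 (fun x : int => x%:~R : F) (cbinS i).
  rewrite /cbin !rmorphM /= !rmorph_nat natrM natrD natrM => ->; ring.
have em : 2%:R * m%:R + 1 = 0 :> F by rewrite -four_r /m natrM; ring.
have e1 : i.+1%:R * 'C(m, i.+1)%:R = (m%:R - i%:R) * 'C(m, i)%:R :> F.
  rewrite -natrM mul_bin_left; case: (leqP i m) => [le|lt].
    by rewrite natrM natrB.
  by rewrite (bin_small lt) muln0 !mulr0.
have e2 : i.+1%:R * 'C(m + i.+1, i.+1)%:R = (m%:R + i%:R + 1) * 'C(m + i, i)%:R :> F.
  by rewrite -natrM addnS -mul_bin_diag natrM -natr1 natrD.
split; apply: (mulfI i1); rewrite ecb.
  rewrite IH1 exprS; transitivity (- 4%:R * (- 4%:R) ^+ i * (i.+1%:R * 'C(m, i.+1)%:R) : F); last by ring.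
  rewrite e1; move: ((- 4%:R : F) ^+ i) ('C(m, i)%:R : F) => x y.
  transitivity ((2%:R * (2%:R * i%:R + 1) - 2%:R * (2%:R * m%:R + 1)) * x * y); last by ring.
  by rewrite em; ring.
rewrite IH2 exprS; transitivity (4%:R * 4%:R ^+ i * (i.+1%:R * 'C(m + i.+1, i.+1)%:R) : F); last by ring.
rewrite e2; move: ((4%:R : F) ^+ i) ('C(m + i, i)%:R : F) => x y.
transitivity ((2%:R * (2%:R * i%:R + 1) + 2%:R * (2%:R * m%:R + 1)) * x * y); last by ring.
by rewrite em; ring.
Qed.

(** Up to the power of 2, the left side is the Legendre polynomial of degree m at
    0, since the sum of (m choose i) (m + i choose i) w^i is the Legendre
    polynomial at 1 + 2 w, and 2 w = -1. It is read off as the coefficient of X^m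
    in ((1 + X) (1 - X))^m. *)
Lemma hasse_value (h : F) : 32%:R * h = 1 ->
  2%:R ^+ m * \sum_(i < p) 'C(2 * i, i)%:R ^+ 2 * h ^+ i = (-1) ^+ r * 'C(m, r)%:R :> F.
Proof.
move=> eh; pose w : F := - 16%:R * h.
have e2w : 2%:R * w = -1.
  by transitivity (- (32%:R * h)); [rewrite /w; ring | rewrite eh].
have -> : \sum_(i < p) 'C(2 * i, i)%:R ^+ 2 * h ^+ i
    = \sum_(i < m.+1) w ^+ i * 'C(m, i)%:R * 'C(m + i, i)%:R :> F.
  have le_mp : (m.+1 <= p)%N by rewrite /m; lia.
  rewrite (big_ord_widen _ (fun i => w ^+ i * 'C(m, i)%:R * 'C(m + i, i)%:R : F) le_mp).
  rewrite [RHS]big_mkcond; apply: eq_bigr => i _ /=.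
  have [c1 c2] := cbin_mod (ltn_ord i).
  have -> : 'C(2 * i, i)%:R ^+ 2 * h ^+ i = w ^+ i * 'C(m, i)%:R * 'C(m + i, i)%:R :> F.
    rewrite expr2 {1}c1 c2 /w; have -> : - 16%:R * h = - 4%:R * 4%:R * h by ring.
    by rewrite !exprMn; ring.
  by case: ltnP => // lt; rewrite (bin_small lt) mulr0 mul0r.
clearbody w.
have gen : \sum_(i < m.+1) (w ^+ i * 'C(m, i)%:R)%:P * (1 + 'X) ^+ (m + i)
    = (1 + 'X) ^+ m * (1 + w%:P * (1 + 'X)) ^+ m :> {poly F}.
  rewrite [(1 + w%:P * _) ^+ m]exprDn mulr_sumr; apply: eq_bigr => i _.
  rewrite expr1n mul1r exprMn exprD polyCM (rmorphXn (@polyC F)) rmorph_nat.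
  by rewrite -[(_ ^+ i * _) *+ 'C(m, i)]mulr_natl; ring.
have val : \sum_(i < m.+1) w ^+ i * 'C(m, i)%:R * 'C(m + i, i)%:R
   = ((1 + 'X) ^+ m * (1 + w%:P * (1 + 'X)) ^+ m : {poly F})`_m.
  rewrite -gen coef_sum; apply: eq_bigr => i _; rewrite coefCM coef_expr1DX.
  by have -> : 'C(m + i, m) = 'C(m + i, i) by rewrite -bin_sub ?leq_addr // addKn.
rewrite val -coefCM rmorphXn mulrCA -exprMn -exprMn /=.
have -> : (1 + 'X) * (2%:R%:P * (1 + w%:P * (1 + 'X))) = 1 - 'X^2 :> {poly F}.
  transitivity ((1 + 'X) * (2%:R + (2%:R * w)%:P * (1 + 'X)) : {poly F}).
    by rewrite polyCM !rmorph_nat; ring.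
  by rewrite e2w polyCN polyC1; ring.
rewrite exprDn coef_sum.
have lt_r : (r < m.+1)%N by rewrite /m; lia.
have term (i : 'I_m.+1) : ((1 ^+ (m - i) * (- 'X^2) ^+ i *+ 'C(m, i)) : {poly F})`_m
    = if i == r :> nat then (-1) ^+ r * 'C(m, r)%:R else 0.
  have -> : (- 'X^2) ^+ i = ((-1) ^+ i)%:P * 'X^(2 * i) :> {poly F}.
    rewrite (exprNn 'X^2) -exprM; congr (_ * _).
    by rewrite [RHS](rmorphXn (@polyC F)) [X in _ = X ^+ _]polyCN.
  rewrite expr1n mul1r coefMn coefCM coefXn.
  have -> : (m == 2 * i)%N = (i == r :> nat) by rewrite /m eqn_mul2l eq_sym.
  case: eqP => [->|_] /=; first by rewrite mulr1 mulr_natr.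
  by rewrite mulr0n mulr0 mul0rn.
rewrite (eq_bigr _ (fun i _ => term i)) -big_mkcond (big_pred1 (Ordinal lt_r)) //.
Qed.

(** As in Gauss's lemma: m! is the product of the even numbers 2, 4, ..., 2 r and
    the odd numbers below m. The latter are the negatives of the doubles of
    m, m - 1, ..., r + 1, because 2 m + 1 = p. *)
Lemma two_pow : 2%:R ^+ m = (-1) ^+ r :> F.
Proof.
have odd_even : (m`! = \prod_(i < r) ((2 * i).+2 * (2 * i).+1))%N.
  rewrite /m; elim: (r) => [|k IH]; first by rewrite big_ord0.
  by rewrite mulnS !addSn add0n !factS IH big_ord_recr /= mulnA mulnC.
have fact0 : (m`!)%:R != 0 :> F.
  have em : (m + m = p.-1)%N by rewrite /m p_eq; lia.
  have := wilson_split em; case: eqP => // -> /eqP.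
  by rewrite !mul0r eq_sym oppr_eq0 oner_eq0.
apply: (mulIf fact0).
have e1 : (m`! = r`! * \prod_(i < r) (m - i))%N.
  have [le_rm em] : (r <= m /\ m - r = r)%N by rewrite /m; lia.
  by rewrite -ffact_prod -(ffact_fact le_rm) em mulnC.
have e2 : (2 ^ r * r`! = \prod_(i < r) (2 * i).+2)%N.
  elim: (r) => [|k IH]; first by rewrite big_ord0.
  by rewrite big_ord_recr -IH factS expnS /=; lia.
have -> : 2%:R ^+ m * (m`!)%:R
    = (2 ^ r * r`!)%:R * \prod_(i < r) (2 * (m - i))%:R :> F.
  rewrite e1 /m mul2n -addnn exprD !natrM natrX natr_prod.
  under [in RHS]eq_bigr => i _ do rewrite natrM.
  by rewrite big_split /= prodr_const card_ord; ring.
have -> : \prod_(i < r) (2 * (m - i))%:R = \prod_(i < r) (-1 * (2 * i).+1%:R) :> F.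
  apply: eq_bigr => i _; have lt_i := ltn_ord i.
  have : (2 * (m - i))%:R + (2 * i).+1%:R == 0 :> F.
    by rewrite -natrD -p_eq0; apply/eqP; congr _%:R; rewrite /m p_eq; lia.
  by rewrite addr_eq0 mulN1r => /eqP.
rewrite big_split /= prodr_const card_ord e2 odd_even !natr_prod.
under [in RHS]eq_bigr => i _ do rewrite natrM.
by rewrite big_split /=; ring.
Qed.

Lemma cong_F (x y : int) : cong p x y <-> x%:~R = y%:~R :> F.
Proof.
rewrite cong_intP (dvdz_pcharf charF) rmorphB subr_eq0.
by split=> [/eqP|/eqP].
Qed.

Definition prod4 (k : nat) : int := \prod_(j < k) (4 * j + 3)%:R.

(** 4 (r + j + 1) = 4 j + 3 modulo p = 4 r + 1, and 4^m = 1; so the product of the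
    4 j + 3 is that of r + 1, ..., 3 r. *)
Lemma prod4_mod : (r`!)%:R * (prod4 m)%:~R = ((3 * r)`!)%:R :> F.
Proof.
have four_m : 4%:R ^+ m = 1 :> F.
  have -> : 4%:R = 2%:R ^+ 2 :> F by ring.
  by rewrite -exprM mulnC exprM two_pow sqrr_sign.
have e (k : nat) : (r`! * \prod_(j < k) (r + j.+1) = (r + k)`!)%N.
  elim: k => [|k IH]; first by rewrite big_ord0 muln1 addn0.
  by rewrite big_ord_recr mulnA IH addnS factS mulnC.
have -> : (3 * r = r + m)%N by rewrite /m; lia.
rewrite -e natrM natr_prod; congr (_ * _).
rewrite /prod4 rmorph_prod.
transitivity (\prod_(j < m) (4%:R * (r + j.+1)%:R) : F); last first.
  by rewrite big_split /= prodr_const card_ord four_m mul1r.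
apply: eq_bigr => j _; rewrite rmorph_nat -natrM.
by apply: (@natF _ _ 1 0); rewrite p_eq; lia.
Qed.

(** After multiplication by r!^4 both sides are powers of -1, by Wilson's theorem
    split at m and at r. *)
Lemma hasse_square (H : F) : 2%:R ^+ m * H = (-1) ^+ r * 'C(m, r)%:R ->
  8%:R ^+ m * H ^+ 2 = (-1) ^+ r.+1 * (prod4 m)%:~R ^+ 2.
Proof.
move=> eH.
have fr : (r`!)%:R != 0 :> F.
  have er : (3 * r + r = p.-1)%N by rewrite p_eq; lia.
  have := wilson_split er; case: eqP => // -> /eqP.
  by rewrite mulr0 mul0r eq_sym oppr_eq0 oner_eq0.
have em : (m`!)%:R ^+ 2 = -1 :> F.
  have em : (m + m = p.-1)%N by rewrite /m p_eq; lia.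
  by rewrite -(wilson_split em) /m exprM sqrrN expr1n -expr2 expr1n mulr1.
have e3 : ((3 * r)`!)%:R * (r`!)%:R = - (-1) ^+ r :> F.
  have er : (3 * r + r = p.-1)%N by rewrite p_eq; lia.
  have := wilson_split er => /(congr1 (fun x => x * (-1) ^+ r)).
  by rewrite -mulrA -expr2 sqrr_sign mulr1 mulN1r.
have eC : 'C(m, r)%:R * (r`!)%:R ^+ 2 = (m`!)%:R :> F.
  have [le_rm emr] : (r <= m /\ m - r = r)%N by rewrite /m; lia.
  by rewrite -(bin_fact le_rm) emr !natrM.
have e8 : 8%:R ^+ m * H ^+ 2 = (-1) ^+ r * 'C(m, r)%:R ^+ 2.
  transitivity (2%:R ^+ m * (2%:R ^+ m * H) ^+ 2).
    by rewrite (_ : 8%:R = 2%:R * 2%:R * 2%:R) ?exprMn -?natrM //; ring.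
  by rewrite eH two_pow exprMn sqrr_sign mul1r.
apply: (mulIf (expf_neq0 4 fr)); rewrite e8.
transitivity ((-1) ^+ r * ('C(m, r)%:R * (r`!)%:R ^+ 2) ^+ 2 : F); first by ring.
rewrite eC em.
transitivity ((-1) ^+ r.+1 * ((r`!)%:R * (prod4 m)%:~R * (r`!)%:R) ^+ 2 : F); last by ring.
by rewrite prod4_mod e3 sqrrN sqrr_sign exprS; ring.
Qed.

Lemma yp_value (h : int) : cong p (32%:R * h) 1 ->
  2%:R ^+ m * (at_ h (yp p))%:~R = (-1) ^+ r * 'C(m, r)%:R :> F.
Proof.
move=> /cong_F; rewrite rmorphM rmorph_nat rmorph1 => /hasse_value <-; congr (_ * _).
rewrite /yp /horner_eval horner_sum rmorph_sum; apply: eq_bigr => i _.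
by rewrite hornerM hornerC hornerXn rmorphM !rmorphXn /= rmorph_nat.
Qed.

Lemma yp_ndvd (h : int) : cong p (32%:R * h) 1 -> ~~ (p%:Z %| at_ h (yp p))%Z.
Proof.
move=> ch; rewrite (dvdz_pcharf charF); apply/eqP => y0.
have [le_rm emr] : (r <= m /\ m - r = r)%N by rewrite /m; lia.
have em : (m + m = p.-1)%N by rewrite /m p_eq; lia.
have := yp_value ch; rewrite y0 mulr0 => /esym/eqP.
rewrite mulf_eq0 signr_eq0 /= => /eqP C0.
have := wilson_split em; rewrite -{1}(bin_fact le_rm) natrM C0 !mul0r => /eqP.
by rewrite eq_sym oppr_eq0 oner_eq0.
Qed.

(** Raising the constant from modulo p to modulo p^e costs a p^(e-1)-th power,
    which is odd and so preserves the sign. *)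
Theorem periodicity (e n : nat) (h : int) (d : nat -> int) :
  (0 < e)%N -> (e <= 2 * n)%N -> cong ((p ^ e) ^ 2) (32%:R * h) 1 ->
  (forall k, cong (p ^ e) (d k) (8%:R ^+ k * evr h 0 (P (2 * k)))) ->
  cong (p ^ e) (d (n + p ^ e.-1 * m)%N)
    ((-1) ^+ r.+1 * prod4 m ^+ (2 * p ^ e.-1) * d n).
Proof.
move=> e_gt0 le_en ch cd.
have p_gt2 : (2 < p)%N by have := prime_gt1 pr_p; lia.
have ch1 : cong p (32%:R * h) 1.
  by apply: cong_dvd ch; rewrite -expnM; apply: dvdn_exp; rewrite // muln_gt0 e_gt0.
have unit_p := yp_ndvd ch1.
have cP := P_cong pr_p p_gt2 e_gt0 le_en ch unit_p.
have cC : cong p (8%:R ^+ m * at_ h (yp p) ^+ 2) ((-1) ^+ r.+1 * prod4 m ^+ 2).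
  apply/cong_F; have := hasse_square (yp_value ch1).
  by rewrite !rmorphM !rmorphXn rmorphN rmorph1 rmorph_nat.
have := cong_exppX e.-1 cC; rewrite prednK // => {}cC.
have -> : (-1) ^+ r.+1 * prod4 m ^+ (2 * p ^ e.-1)
    = ((-1) ^+ r.+1 * prod4 m ^+ 2) ^+ (p ^ e.-1) :> int.
  rewrite exprMn -!exprM; congr (_ * _); rewrite mulnC exprM.
  by rewrite -[in RHS]signr_odd oddX p_eq oddD oddM /= orbT expr1.
apply: cong_trans (cd _) _; apply: cong_trans; last exact: congM cC (cong_sym (cd n)).
have -> : (2 * (n + p ^ e.-1 * m) = 2 * n + p ^ e.-1 * p.-1)%N by rewrite /m p_eq; lia.
apply: cong_trans (congMl _ cP) _.
suff -> : 8%:R ^+ (n + p ^ e.-1 * m) * (at_ h (yp p) ^+ (2 * p ^ e.-1) * evr h 0 (P (2 * n)))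
  = (8%:R ^+ m * at_ h (yp p) ^+ 2) ^+ (p ^ e.-1) * (8%:R ^+ n * evr h 0 (P (2 * n))).
  exact: cong_refl.
by rewrite exprD exprMn -!exprM [(p ^ _ * m)%N]mulnC; ring.
Qed.

End PrimeField.
End Constants.

(** * From the real value at 1/32 to residues *)

Module Center.
Import Terms.
Local Open Scope Z_scope.

Definition evZ (k l : Z) := ev Z Z.add Z.mul (fun z => z) k l.
Definition evR (k l : R) := ev R Rplus Rmult IZR k l.

(** A power of 32 clears the denominators of a value at 1/32; its residue is then
    the value at any inverse of 32. *)
Lemma ev_center (N h : Z) (Hh : (N | 32 * h - 1)) (t : tm) :
  exists (K : nat) (z : Z),
    IZR z = (32 ^ K * evR (1 / 32) 0 t)%R
    /\ (N | z - 32 ^ Z.of_nat K * evZ h 0 t).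
Proof.
  induction t as [| | c | s [K1 [z1 [E1 D1]]] t [K2 [z2 [E2 D2]]]
                 | s [K1 [z1 [E1 D1]]] t [K2 [z2 [E2 D2]]]].
  - exists 1%nat, 1; split; [simpl; lra |].
    replace (1 - 32 ^ Z.of_nat 1 * evZ h 0 Kap) with (- (32 * h - 1))
      by (change (Z.of_nat 1) with 1; unfold evZ; cbn [ev]; ring).
    now apply Z.divide_opp_r.
  - exists 0%nat, 0; split; [simpl; ring | apply Z.divide_0_r].
  - exists 0%nat, c; split; [simpl; ring |].
    replace (_ - _) with 0; [apply Z.divide_0_r|].
    change (Z.of_nat 0) with 0; unfold evZ; cbn [ev]; ring.
  - exists (K1 + K2)%nat, (z1 * 32 ^ Z.of_nat K2 + z2 * 32 ^ Z.of_nat K1); split.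
    + rewrite plus_IZR, !mult_IZR, <- !pow_IZR, E1, E2, pow_add; unfold evR; simpl; ring.
    + rewrite Nat2Z.inj_add, Z.pow_add_r by lia.
      replace (_ - _) with ((z1 - 32 ^ Z.of_nat K1 * evZ h 0 s) * 32 ^ Z.of_nat K2
        + (z2 - 32 ^ Z.of_nat K2 * evZ h 0 t) * 32 ^ Z.of_nat K1)
        by (unfold evZ; cbn [ev]; ring).
      apply Z.divide_add_r; now apply Z.divide_mul_l.
  - exists (K1 + K2)%nat, (z1 * z2); split.
    + rewrite mult_IZR, E1, E2, pow_add; unfold evR; simpl; ring.
    + rewrite Nat2Z.inj_add, Z.pow_add_r by lia.
      replace (_ - _) with ((z1 - 32 ^ Z.of_nat K1 * evZ h 0 s) * z2
        + (z2 - 32 ^ Z.of_nat K2 * evZ h 0 t) * (32 ^ Z.of_nat K1 * evZ h 0 s))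
        by (unfold evZ; cbn [ev]; ring).
      apply Z.divide_add_r; now apply Z.divide_mul_l.
Qed.

Lemma center_cong (N h : Z) (Hh : (N | 32 * h - 1)) (d : Z) (k : nat) (t : tm) :
  IZR d = (8 ^ k * evR (1 / 32) 0 t)%R ->
  (N | d - 8 ^ Z.of_nat k * evZ h 0 t).
Proof.
  intros Hd; destruct (ev_center N h Hh t) as [K [z [Ez Dz]]].
  assert (e : 32 ^ Z.of_nat K * d = 8 ^ Z.of_nat k * z).
  { apply eq_IZR; rewrite !mult_IZR, <- !pow_IZR, Hd, Ez; ring. }
  assert (u : (N | (32 * h) ^ Z.of_nat K - 1)).
  { clear - Hh; induction K as [|K IH]; [apply Z.divide_0_r|].
    rewrite Nat2Z.inj_succ, Z.pow_succ_r by lia.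
    replace (_ - 1) with (32 * h * ((32 * h) ^ Z.of_nat K - 1) + (32 * h - 1)) by ring.
    apply Z.divide_add_r; [now apply Z.divide_mul_r | assumption]. }
  set (x := evZ h 0 t) in *.
  rewrite Z.pow_mul_l in u.
  set (A := 32 ^ Z.of_nat K) in *; set (B := h ^ Z.of_nat K) in *.
  set (E := 8 ^ Z.of_nat k) in *.
  replace (d - E * x) with (B * E * (z - A * x) + - ((A * B - 1) * (d - E * x))).
  - apply Z.divide_add_r; [now apply Z.divide_mul_r|].
    now apply Z.divide_opp_r, Z.divide_mul_l.
  - transitivity (B * (E * z) - B * E * A * x - (A * B - 1) * (d - E * x)); [ring|].
    rewrite <- e; ring.
Qed.

End Center.

Module Bridge.
Import HB.structures all_boot all_order all_algebra ring zify.
Import GRing.Theory.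
Import Terms Cusp Constants Center.
Set Implicit Arguments. Unset Strict Implicit. Unset Printing Implicit Defensive.
Local Open Scope ring_scope.

Notation zi := ssrZ.Z_of_int.
Notation iz := ssrZ.int_of_Z.

Lemma ziD x y : zi (x + y) = Z.add (zi x) (zi y). Proof. lia. Qed.
Lemma ziM x y : zi (x * y) = Z.mul (zi x) (zi y). Proof. lia. Qed.
Lemma ziX x k : zi (x ^+ k) = Z.pow (zi x) (Z.of_nat k).
Proof.
elim: k => [|k IH] //; rewrite exprS ziM IH Nat2Z.inj_succ Z.pow_succ_r //; lia.
Qed.

Lemma zi_evr h t : zi (evr h 0 t) = evZ (zi h) 0 t.
Proof.
elim: t => [||z|s IHs t IHt|s IHs t IHt] //.
- by rewrite evr_Cst intz ssrZ.int_of_ZK.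
- by rewrite evr_Add ziD IHs IHt.
- by rewrite evr_Mul ziM IHs IHt.
Qed.

Lemma cong_zi N x y : cong N x y <-> Z.divide (Z.of_nat N) (Z.sub (zi x) (zi y)).
Proof.
split=> [[q ->]|[q e]].
  by exists (zi q); rewrite ziD ziM natz; lia.
by exists (iz q); rewrite -[x]ssrZ.Z_of_intK natz; nia.
Qed.

Lemma zi_prod4 k : zi (prod4 k) = prod_4j_sub_1 k.
Proof.
elim: k => [|k IH]; first by rewrite /prod4 big_ord0.
rewrite /prod4 big_ord_recr ziM -/(prod4 k) IH /prod_4j_sub_1.
rewrite List.seq_S List.map_app List.fold_right_app /=.
have fold (l : list Z) x : List.fold_right Z.mul x l = Z.mul (List.fold_right Z.mul (Zpos xH) l) x.
  by elim: l => [|z l IHl] /=; [case: x | rewrite IHl Z.mul_assoc].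
by rewrite [RHS]fold natz; congr Z.mul; lia.
Qed.

Lemma expn_pow p k : (p ^ k)%N = Nat.pow p k.
Proof. by elim: k => //= k IH; rewrite expnS IH; lia. Qed.

Lemma prime_prime p : Znumtheory.prime (Z.of_nat p) -> prime p.
Proof.
move=> pr_p; have p_ge2 := Znumtheory.prime_ge_2 _ pr_p.
apply/primeP; split; first lia.
move=> k /dvdnP[j e]; apply/orP.
have : Z.divide (Z.of_nat k) (Z.of_nat p) by exists (Z.of_nat j); lia.
by move/(Znumtheory.prime_divisors _ pr_p); lia.
Qed.

(** 32 = 2^5, and (N + 1) / 2 is an inverse of 2. *)
Lemma inverse_32 N : odd N -> exists h : int, cong N (32%:R * h) 1.
Proof.
move=> oddN; exists (N.+1./2%:Z ^+ 5).
have -> : 32%:R * N.+1./2%:Z ^+ 5 = (N%:R + 1) ^+ 5 :> int.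
  rewrite (_ : N%:R + 1 = 2%:R * N.+1./2%:Z); first by ring.
  by rewrite natz; have := odd_double_half N.+1; rewrite /= oddN; lia.
rewrite -[X in cong _ _ X](expr1n _ 5); apply: congX.
by exists 1; ring.
Qed.

Theorem real_periodicity (d : nat -> Z) (p r e n : nat) :
  Znumtheory.prime (Z.of_nat p) -> p = Nat.add (Nat.mul 4 r) 1 -> le 1 e -> le e (Nat.mul 2 n) ->
  (forall k, IZR (d k) = Rmult (pow (IZR 8) k) (evR (Rdiv (IZR 1) (IZR 32)) (IZR 0) (P (Nat.mul 2 k)))) ->
  Z.divide (Z.of_nat (Nat.pow p e))
    (Z.sub (d (Nat.add n (Nat.mul (Nat.pow p (Nat.sub e 1)) (Nat.mul 2 r))))
       (Z.mul (Z.mul (Z.pow (Zneg xH) (Z.of_nat (S r)))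
                     (Z.pow (prod_4j_sub_1 (Nat.mul 2 r)) (Z.of_nat (Nat.mul 2 (Nat.pow p (Nat.sub e 1))))))
              (d n))).
Proof.
move=> /prime_prime pr_p p_eq /leP e_gt0 /leP le_en hd.
rewrite -!expn_pow -[Nat.sub e 1]/(e - 1)%N subn1.
have {}p_eq : p = (4 * r + 1)%N := p_eq.
have odd_p : odd p by rewrite p_eq oddD oddM.
have [h ch] : exists h : int, cong ((p ^ e) ^ 2) (32%:R * h) 1.
  by apply: inverse_32; rewrite !oddX odd_p orbT.
have ch1 : cong (p ^ e) (32%:R * h) 1.
  by apply: cong_dvd ch; rewrite -mulnn dvdn_mulr.
have cd k : cong (p ^ e) (iz (d k)) (8%:R ^+ k * evr h 0 (P (2 * k))).
  apply/cong_zi; rewrite ssrZ.int_of_ZK ziM ziX zi_evr.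
  apply: center_cong (hd k).
  by have /cong_zi := ch1; rewrite ziM.
have /cong_zi := periodicity pr_p p_eq e_gt0 le_en ch cd.
by rewrite !ziM !ssrZ.int_of_ZK !ziX zi_prod4.
Qed.

End Bridge.

(** * The q-series as real functions *)

Module RealCoefficients.
Import HB.structures all_boot all_order all_algebra ring zify.
Import GRing.Theory.
Import PowerSeries ThetaSeries Bridge.
Set Implicit Arguments. Unset Strict Implicit. Unset Printing Implicit Defensive.
Local Open Scope ring_scope.

Definition rc (f : fps int) (n : nat) : R := IZR (ssrZ.Z_of_int (cf f n)).

Lemma rc_sub f g n : rc (f - g) n = Rminus (rc f n) (rc g n).
Proof. by rewrite /rc cfB (_ : zi _ = Z.sub (zi (cf f n)) (zi (cf g n))) ?minus_IZR //; lia. Qed.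

Lemma rc_natmul k f n : rc (k%:R * f) n = Rmult (INR k) (rc f n).
Proof. by rewrite /rc cf_natmul ziM mult_IZR natz INR_IZR_INZ. Qed.

Lemma rc_mul f g n : rc (f * g) n = PSeries.PS_mult (rc f) (rc g) n.
Proof.
rewrite /rc cfM /PSeries.PS_mult.
have partial N : (N <= n)%N ->
  IZR (ssrZ.Z_of_int (\sum_(i < N.+1) cf f i * cf g (n - i))) =
  sum_f_R0 (fun k => Rmult (rc f k) (rc g (Nat.sub n k))) N.
  elim: N => [|N IH] le_Nn; rewrite big_ord_recr /=.
    by rewrite big_ord0 /rc ziD ziM plus_IZR mult_IZR Rplus_0_l.
  by rewrite -IH ?(ltnW le_Nn) // ziD ziM plus_IZR mult_IZR.
exact: partial.
Qed.

Lemma rc_D f n : rc (D f) n = Rmult (INR n) (rc f n).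
Proof. by rewrite /rc cf_D ziM mult_IZR natz INR_IZR_INZ. Qed.

Lemma rc_theta_0 : rc theta 0 = IZR 1.
Proof. by []. Qed.

Lemma rc_theta_sqr k : rc theta (Nat.mul (S k) (S k)) = IZR 2.
Proof.
have -> : Nat.mul (S k) (S k) = (k.+1 ^ 2)%N by rewrite -mulnn.
by rewrite /rc -[cf theta _]/(Posz (nsqrt _)) nsqrt_sqr.
Qed.

Lemma rc_theta_gap k n :
  lt (Nat.mul k k) n -> lt n (Nat.mul (S k) (S k)) -> rc theta n = IZR 0.
Proof.
move=> lt1 lt2; rewrite /rc /= (@nsqrt_gap k) // -!mulnn.
by apply/andP; split; apply/ltP.
Qed.

Lemma rc_theta_bound n : Rle (Rabs (rc theta n)) (IZR 2).
Proof.
have [c [le_c lt_c]] : exists c, (c ^ 2 <= n)%N /\ (n < c.+1 ^ 2)%N.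
  have [le_c lt_c] := Nat.sqrt_spec n (Nat.le_0_l _).
  by exists (Nat.sqrt n); rewrite -!mulnn; split; apply/leP.
rewrite /rc -[cf theta n]/(Posz (nsqrt n)); move: le_c.
rewrite leq_eqVlt => /orP[/eqP <-|lt]; last first.
  by rewrite (@nsqrt_gap c) ?lt //= Rabs_R0; lra.
case: c {lt_c} => [|c]; first by rewrite nsqrt0 /= Rabs_R1; lra.
by rewrite nsqrt_sqr /= Rabs_pos_eq; lra.
Qed.

Lemma rc_theta4 n : rc theta4 n = Rmult (pow (Ropp (IZR 1)) n) (rc theta n).
Proof.
have e k : IZR (ssrZ.Z_of_int ((-1) ^+ k)) = pow (Ropp (IZR 1)) k.
  elim: k => [//|k IH]; by rewrite exprS ziM mult_IZR IH.
by rewrite /rc cf_negvar ziM mult_IZR e.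
Qed.

End RealCoefficients.

Module RealPowerSeries.
Import Coquelicot.Coquelicot.
Local Open Scope R_scope.
Local Set Bullet Behavior "Strict Subproofs".

(** Convergence on the open unit disc, as an intrinsic property of coefficients
    that is stable under the ring operations and q d/dq. *)
Definition conv (a : nat -> R) :=
  forall q, Rabs q < 1 -> Rbar_lt (Rabs q) (CV_radius a).

Lemma is_series_0 : is_series (fun _ => 0) 0.
Proof.
  change (is_lim_seq (sum_n (fun _ => 0)) 0).
  apply (is_lim_seq_ext (fun _ => 0)); [|apply is_lim_seq_const].
  intros n; rewrite sum_n_const; ring.
Qed.

Lemma conv_ext a b : (forall n, a n = b n) -> conv a -> conv b.
Proof. intros e Ha q Hq; rewrite <- (CV_radius_ext a b e); auto. Qed.

Lemma conv_ex_pseries a :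
  (forall q, Rabs q < 1 -> ex_pseries a q) -> conv a.
Proof.
  intros Ha q Hq; apply Rbar_not_le_lt; intros Hle.
  set (x := (Rabs q + 1) / 2).
  assert (Hx : Rabs x = x) by (apply Rabs_pos_eq; assert (h := Rabs_pos q); unfold x; lra).
  apply (CV_disk_outside a x).
  - apply Rbar_le_lt_trans with (Rabs q); [assumption|].
    rewrite Hx; simpl; unfold x; lra.
  - apply ex_series_lim_0.
    destruct (Ha x) as [l Hl]; [rewrite Hx; unfold x; lra|].
    exists l; eapply is_series_ext; [|exact Hl].
    intros n; simpl; unfold scal; simpl; unfold mult; simpl.
    rewrite pow_n_pow; ring.
Qed.

Lemma conv_bounded a M : (forall n, Rabs (a n) <= M) -> conv a.
Proof.
  intros Ha; apply conv_ex_pseries; intros q Hq.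
  apply ex_series_Rabs.
  apply (ex_series_le (V := R_CompleteNormedModule) _ (fun n => M * Rabs q ^ n)).
  - intros n; unfold norm; simpl; unfold abs; simpl.
    unfold scal; simpl; unfold mult; simpl.
    rewrite Rabs_Rabsolu, Rabs_mult, pow_n_pow, <- RPow_abs.
    rewrite Rmult_comm; apply Rmult_le_compat_r; [apply pow_le, Rabs_pos | apply Ha].
  - apply (ex_series_scal (K := R_AbsRing) (V := R_NormedModule) M (fun n => Rabs q ^ n)).
    apply ex_series_geom; rewrite Rabs_Rabsolu; assumption.
Qed.

Lemma conv_mult a b : conv a -> conv b -> conv (PS_mult a b).
Proof.
  intros Ha Hb; apply conv_ex_pseries; intros q Hq; apply ex_pseries_mult; auto.
Qed.

Lemma conv_scal c a : conv a -> conv (PS_scal c a).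
Proof.
  intros Ha; apply conv_ex_pseries; intros q Hq.
  apply ex_pseries_scal; [apply Rmult_comm | apply CV_radius_inside; auto].
Qed.

Lemma conv_minus a b : conv a -> conv b -> conv (PS_minus a b).
Proof.
  intros Ha Hb; apply conv_ex_pseries; intros q Hq.
  apply ex_pseries_minus; apply CV_radius_inside; auto.
Qed.

Definition PS_D (a : nat -> R) : nat -> R := fun n => INR n * a n.

Lemma PS_D_incr a n : PS_incr_1 (PS_derive a) n = PS_D a n.
Proof. destruct n as [|n]; [simpl; unfold PS_D; simpl; unfold zero; simpl; ring | reflexivity]. Qed.

Lemma conv_D a : conv a -> conv (PS_D a).
Proof.
  intros Ha; apply (conv_ext (PS_incr_1 (PS_derive a))); [apply PS_D_incr|].
  intros q Hq; rewrite CV_radius_incr_1, CV_radius_derive; auto.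
Qed.

Lemma is_derive_D a q : conv a -> Rabs q < 1 -> q <> 0 ->
  is_derive (PSeries a) q (PSeries (PS_D a) q / q).
Proof.
  intros Ha Hq q0.
  replace (PSeries (PS_D a) q / q) with (PSeries (PS_derive a) q).
  - apply is_derive_PSeries; auto.
  - rewrite <- (PSeries_ext _ _ q (PS_D_incr a)), PSeries_incr_1; field; auto.
Qed.

End RealPowerSeries.

Module RealTheta.
Import Coquelicot.Coquelicot.
Import HB.structures all_boot all_order all_algebra ring zify.
Import GRing.Theory.
Import PowerSeries ThetaSeries RealCoefficients RealPowerSeries.
Set Implicit Arguments. Unset Strict Implicit. Unset Printing Implicit Defensive.
Local Open Scope ring_scope.

Definition Dz (f : fps int) : fps int := D f.

Definition ev (f : fps int) (q : R) : R := PSeries (rc f) q.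

Section UnitDisc.
Variable q : R.
Hypothesis q1 : Rlt (Rabs q) (IZR 1).
Variables f g : fps int.
Hypotheses (cf : conv (rc f)) (cg : conv (rc g)).

Lemma conv_fsub : conv (rc (f - g)).
Proof. by apply: conv_ext (conv_minus _ _ cf cg) => n; rewrite rc_sub. Qed.
Lemma conv_fmul : conv (rc (f * g)).
Proof. by apply: conv_ext (conv_mult _ _ cf cg) => n; rewrite rc_mul. Qed.
Lemma conv_fnat k : conv (rc (k%:R * f)).
Proof. by apply: conv_ext (conv_scal (INR k) _ cf) => n; rewrite rc_natmul. Qed.
Lemma conv_fD : conv (rc (Dz f)).
Proof. by apply: conv_ext (conv_D _ cf) => n; rewrite rc_D. Qed.

Lemma ev_sub : ev (f - g) q = Rminus (ev f q) (ev g q).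
Proof.
rewrite /ev -PSeries_minus; try (by apply: CV_radius_inside; auto).
by apply: PSeries_ext => n; rewrite rc_sub.
Qed.
Lemma ev_mul : ev (f * g) q = Rmult (ev f q) (ev g q).
Proof.
rewrite /ev -PSeries_mult; auto.
by apply: PSeries_ext => n; rewrite rc_mul.
Qed.
Lemma ev_nat k : ev (k%:R * f) q = Rmult (INR k) (ev f q).
Proof.
rewrite /ev -PSeries_scal; by apply: PSeries_ext => n; rewrite rc_natmul.
Qed.
Lemma ev_is_derive : q <> IZR 0 -> is_derive (ev f) q (Rdiv (ev (Dz f) q) q).
Proof.
move=> q0; rewrite /ev.
rewrite (PSeries_ext (rc (Dz f)) (PS_D (rc f))); first exact: is_derive_D.
by move=> n; rewrite rc_D.
Qed.
End UnitDisc.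

Lemma conv_theta : conv (rc theta).
Proof. exact: conv_bounded rc_theta_bound. Qed.
Lemma conv_theta4 : conv (rc theta4).
Proof.
apply: (conv_bounded _ (IZR 2)) => n; rewrite rc_theta4 Rabs_mult pow_1_abs Rmult_1_l.
exact: rc_theta_bound.
Qed.
Lemma conv_a : conv (rc a).
Proof. by rewrite aE expr2; apply: conv_fmul; exact: conv_theta. Qed.
Lemma conv_b : conv (rc b).
Proof. by rewrite bE expr2; apply: conv_fmul; exact: conv_theta4. Qed.

Local Hint Resolve conv_theta conv_theta4 conv_a conv_b conv_fsub conv_fmul conv_fnat conv_fD : core.

Section Values.
Variable q : R.
Hypothesis q1 : Rlt (Rabs q) (IZR 1).

Lemma ev_a : ev a q = Rmult (ev theta q) (ev theta q).
Proof. by rewrite aE expr2 ev_mul //; auto. Qed.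
Lemma ev_b : ev b q = Rmult (ev theta4 q) (ev theta4 q).
Proof. by rewrite bE expr2 ev_mul //; auto. Qed.

Lemma ev_wronskian :
  Rmult (INR 2) (Rminus (Rmult (ev b q) (ev (Dz a) q)) (Rmult (ev a q) (ev (Dz b) q))) =
  Rmult (Rmult (ev a q) (ev b q))
    (Rminus (Rmult (ev a q) (ev a q)) (Rmult (ev b q) (ev b q))).
Proof.
have := congr1 (fun f => ev f q) wronskian.
rewrite !expr2 -![D _]/(Dz _).
by rewrite !(ev_nat, ev_mul, ev_sub) //; auto.
Qed.

Lemma ev_second_order :
  Rmult (INR 4) (Rminus (Rmult (ev a q) (ev (Dz (Dz a)) q))
     (Rmult (INR 2) (Rmult (ev (Dz a) q) (ev (Dz a) q)))) =
  Rmult (Rmult (Rmult (ev a q) (ev a q)) (Rmult (ev b q) (ev b q)))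
    (Rminus (Rmult (ev a q) (ev a q)) (Rmult (ev b q) (ev b q))).
Proof.
have := congr1 (fun f => ev f q) second_order.
rewrite !expr2 -![D _]/(Dz _).
by rewrite !(ev_nat, ev_mul, ev_sub) //; auto 10.
Qed.

Lemma ev_D_a : ev (Dz a) q = Rmult (INR 2) (Rmult (ev theta q) (ev (Dz theta) q)).
Proof.
have e : Dz a = 2%:R * (theta * Dz theta) by rewrite /Dz aE (DX theta 1); ring.
by rewrite e ev_nat ev_mul //; auto.
Qed.

End Values.

End RealTheta.

(** * Theta on the imaginary axis *)

Module ThetaOnAxis.
Import Coquelicot.Coquelicot.
Import RealCoefficients RealPowerSeries RealTheta.
Local Open Scope R_scope.
Local Set Bullet Behavior "Strict Subproofs".

Definition th (q : R) : R := ev ThetaSeries.theta q.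
Definition th4 (q : R) : R := ev ThetaSeries.theta4 q.

Lemma sum_theta_gap (q : R) (N j : nat) : (j < 2 * S N + 1)%nat ->
  sum_n (fun n => rc ThetaSeries.theta n * q ^ n) (S N * S N + j)
  = sum_n (fun n => rc ThetaSeries.theta n * q ^ n) (S N * S N).
Proof.
  induction j as [|j IH]; intros Hj; [now rewrite Nat.add_0_r|].
  rewrite Nat.add_succ_r, sum_Sn, IH by lia.
  rewrite (@rc_theta_gap (S N)) by lia; unfold plus; simpl; ring.
Qed.

(** Summing up to a square groups the power series by the values n^2. *)
Lemma sum_theta (q : R) (N : nat) :
  sum_n (fun n => rc ThetaSeries.theta n * q ^ n) (S N * S N)
  = sum_n (fun n => q ^ (n * n)) (S N) + sum_n (fun n => q ^ (S n * S n)) N.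
Proof.
  induction N as [|N IH].
  - rewrite (sum_Sn _ 0), !sum_O; change (1 * 1)%nat with 1%nat.
    rewrite sum_Sn, sum_O, rc_theta_0; change 1%nat with (1 * 1)%nat.
    rewrite rc_theta_sqr; unfold plus; simpl; ring.
  - replace (S (S N) * S (S N))%nat with (S (S N * S N + (2 * S N)))%nat by lia.
    rewrite sum_Sn, sum_theta_gap, IH by lia.
    replace (S (S N * S N + (2 * S N)))%nat with (S (S N) * S (S N))%nat by lia.
    rewrite rc_theta_sqr, (sum_Sn (fun n => q ^ (n * n)) (S N)),
      (sum_Sn (fun n => q ^ (S n * S n)) N).
    cbv beta; generalize (q ^ (S (S N) * S (S N))), (sum_n (fun n => q ^ (n * n)) (S N)),
      (sum_n (fun n => q ^ (S n * S n)) N).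
    intros x u v; unfold plus; simpl; ring.
Qed.

Lemma ex_series_squares (q : R) (f : nat -> nat) : 0 <= q < 1 ->
  (forall n, (n <= f n)%nat) -> ex_series (fun n => q ^ f n).
Proof.
  intros Hq Hf.
  apply (ex_series_le (V := R_CompleteNormedModule) _ (fun n => q ^ n)).
  - intros n; unfold norm; simpl; unfold abs; simpl.
    rewrite Rabs_pos_eq by (apply pow_le; lra).
    replace (f n) with (n + (f n - n))%nat by (specialize (Hf n); lia).
    rewrite pow_add; rewrite <- (Rmult_1_r (q ^ n)) at 2.
    apply Rmult_le_compat_l; [apply pow_le; lra|].
    rewrite <- (pow1 (f n - n)); apply pow_incr; lra.
  - apply ex_series_geom; rewrite Rabs_pos_eq; lra.
Qed.

Lemma th_sum (q : R) : 0 <= q < 1 ->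
  Series (fun n => q ^ (n * n)) + Series (fun n => q ^ (S n * S n)) = th q.
Proof.
  intros Hq.
  assert (H1 := Series_correct _ (ex_series_squares q (fun n => n * n)%nat Hq
    ltac:(intros; nia))).
  assert (H2 := Series_correct _ (ex_series_squares q (fun n => S n * S n)%nat Hq
    ltac:(intros; nia))).
  assert (H3 : is_lim_seq (sum_n (fun n => rc ThetaSeries.theta n * q ^ n)) (th q)).
  { assert (e := Series_correct (fun n => rc ThetaSeries.theta n * q ^ n)).
    apply e, ex_pseries_R, CV_radius_inside, conv_theta; rewrite Rabs_pos_eq; lra. }
  assert (H4 : is_lim_seq (fun N => sum_n (fun n => rc ThetaSeries.theta n * q ^ n) (S N * S N)) (th q)).
  { apply (is_lim_seq_subseq _ _ (fun N => S N * S N)%nat); [|exact H3].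
    apply eventually_subseq; intros n; nia. }
  assert (H5 : is_lim_seq (fun N => sum_n (fun n => rc ThetaSeries.theta n * q ^ n) (S N * S N))
     (Series (fun n => q ^ (n * n)) + Series (fun n => q ^ (S n * S n)))).
  { apply (is_lim_seq_ext (fun N => sum_n (fun n => q ^ (n * n)) (S N)
       + sum_n (fun n => q ^ (S n * S n)) N)).
    - intros N; now rewrite sum_theta.
    - apply is_lim_seq_plus'; [|exact H2].
      now apply (is_lim_seq_incr_1 (sum_n (fun n => q ^ (n * n)))). }
  apply is_lim_seq_unique in H4; apply is_lim_seq_unique in H5.
  rewrite H4 in H5; now injection H5.
Qed.

Definition nome (y : R) : R := exp (- PI * y).

Lemma nome_bounds (y : R) : 0 < y -> 0 < nome y < 1.
Proof.
  intros Hy; split; [apply exp_pos|].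
  rewrite <- exp_0; apply exp_increasing; assert (h := PI_RGT_0); nra.
Qed.

Lemma Cpow_RtoC (q : R) (n : nat) : (RtoC q ^ n)%C = RtoC (q ^ n).
Proof. induction n as [|n IH]; [reflexivity|]; simpl; rewrite IH, RtoC_mult; reflexivity. Qed.

Lemma Cexp_axis (y : R) : Cexp (Ci * PI * (Ci * RtoC y))%C = RtoC (nome y).
Proof.
  replace (Ci * PI * (Ci * RtoC y))%C with (RtoC (- PI * y)).
  - unfold Cexp, nome; simpl; rewrite cos_0, sin_0, Rmult_1_r, Rmult_0_r; reflexivity.
  - apply injective_projections; simpl; ring.
Qed.

Lemma to_nat_sqr (n : nat) : Z.to_nat (Z.of_nat n ^ 2) = (n * n)%nat.
Proof. rewrite Z.pow_2_r, <- Nat2Z.inj_mul; apply Nat2Z.id. Qed.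

Lemma to_nat_sqr_opp (n : nat) : Z.to_nat ((- Z.of_nat n) ^ 2) = (n * n)%nat.
Proof.
  rewrite Z.pow_2_r, Z.mul_opp_opp, <- Nat2Z.inj_mul; apply Nat2Z.id.
Qed.

Lemma CSeries_RtoC (a : nat -> C) (u : nat -> R) :
  (forall n, a n = RtoC (u n)) -> CSeries a = RtoC (Series u).
Proof.
  intros e; unfold CSeries, RtoC; f_equal.
  - apply Series_ext; intros n; now rewrite e.
  - apply is_series_unique, (is_series_ext (fun _ => 0)); [|apply is_series_0].
    intros n; now rewrite e.
Qed.

Lemma theta3_axis (y : R) : 0 < y -> theta3 (Ci * RtoC y)%C = RtoC (th (nome y)).
Proof.
  intros Hy; assert (Hq := nome_bounds y Hy).
  unfold theta3; rewrite Cexp_axis.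
  rewrite <- (th_sum (nome y)), RtoC_plus by lra; f_equal; apply CSeries_RtoC;
    intros n; rewrite ?to_nat_sqr, ?to_nat_sqr_opp; apply Cpow_RtoC.
Qed.

Lemma Csqrt_RtoC (x : R) : 0 <= x -> Csqrt (RtoC x) = RtoC (sqrt x).
Proof.
  intros Hx; unfold Csqrt; rewrite Cmod_R, Rabs_pos_eq by assumption; simpl.
  replace ((x + x) / 2) with x by field; replace ((x - x) / 2) with 0 by field.
  destruct (Rle_dec 0 0) as [_ | n]; [|exfalso; lra].
  now rewrite sqrt_0.
Qed.

End ThetaOnAxis.

(** * The differential system in the coordinate z *)

Module Flow.
Import Coquelicot.Coquelicot.
Import Terms Center RealCoefficients RealPowerSeries RealTheta ThetaOnAxis.
Local Open Scope R_scope.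
Local Set Bullet Behavior "Strict Subproofs".

Lemma Series_nonneg (u : nat -> R) :
  (forall n, 0 <= u n) -> ex_series u -> 0 <= Series u.
Proof.
  intros Hu Eu.
  assert (zero : Series (fun _ : nat => 0) = 0).
  { apply is_series_unique, is_series_0. }
  rewrite <- zero; apply Series_le; [|assumption].
  intros n; split; [lra | apply Hu].
Qed.

Lemma th_ge_1 (q : R) : 0 <= q < 1 -> 1 <= th q.
Proof.
  intros Hq; rewrite <- th_sum by assumption.
  assert (Hp : forall n, 0 <= q ^ n) by (intros; apply pow_le; lra).
  assert (E1 := ex_series_squares q (fun n => n * n)%nat Hq ltac:(intros; nia)).
  assert (E2 := ex_series_squares q (fun n => S n * S n)%nat Hq ltac:(intros; nia)).
  assert (H2 := Series_nonneg _ (fun n => Hp (S n * S n)%nat) E2).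
  rewrite Series_incr_1 by assumption; simpl (q ^ (0 * 0)); lra.
Qed.

Definition ordinate (z : R) : R := (1 + z) / (1 - z).
Definition Q (z : R) : R := nome (ordinate z).

Lemma Q_bounds (z : R) : -1 < z < 1 -> 0 < Q z < 1.
Proof.
  intros Hz; apply nome_bounds; apply Rdiv_lt_0_compat; lra.
Qed.

Lemma is_derive_Q (z : R) : -1 < z < 1 ->
  is_derive Q z (- 2 * PI / (1 - z) ^ 2 * Q z).
Proof.
  intros Hz; unfold Q, nome, ordinate; auto_derive; [lra|].
  change ((1 + z) * / (1 + - z)) with ((1 + z) / (1 - z)).
  generalize (exp (- PI * ((1 + z) / (1 - z)))); intros x; field; lra.
Qed.

Lemma is_derive_ev_Q (f : PowerSeries.fps ssrint.int) (z : R) :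
  conv (rc f) -> -1 < z < 1 ->
  is_derive (fun z => ev f (Q z)) z (- 2 * PI / (1 - z) ^ 2 * ev (Dz f) (Q z)).
Proof.
  intros Hf Hz; assert (HQ := Q_bounds z Hz).
  evar_last.
  - apply (is_derive_comp (ev f) Q); [|apply is_derive_Q; assumption].
    apply ev_is_derive; [rewrite Rabs_pos_eq; lra | assumption | lra].
  - generalize (ev (Dz f) (Q z)); intros x. unfold scal; simpl; unfold mult; simpl; field; lra.
Qed.

Definition A (z : R) : R := ev ThetaSeries.a (Q z).
Definition B (z : R) : R := ev ThetaSeries.b (Q z).
Definition A1 (z : R) : R := ev (Dz ThetaSeries.a) (Q z).
Definition B1 (z : R) : R := ev (Dz ThetaSeries.b) (Q z).
Definition A2 (z : R) : R :=
  ev (Dz (Dz ThetaSeries.a)) (Q z).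
Definition Th (z : R) : R := th (Q z).
Definition Th1 (z : R) : R := ev (Dz ThetaSeries.theta) (Q z).

Definition th0 : R := th (nome 1).
Definition c : R := - PI * th0 ^ 4.

(** These are kappa, ell and theta along the axis. Since ell is only quasi-modular,
    it is corrected by the logarithmic derivative of the factor (1 - z)^(1/2) that
    is split off from theta; with this correction the system is autonomous. *)
Definition kap (z : R) : R := (A z ^ 2 - B z ^ 2) / (16 * A z ^ 2).
Definition ell (z : R) : R := A1 z / A z ^ 3 - (1 - z) / (2 * PI * A z ^ 2).
Definition G (z : R) : R := Th z / (th0 * sqrt (1 - z)).

Lemma th0_ge_1 : 1 <= th0.
Proof. apply th_ge_1; assert (h := nome_bounds 1 Rlt_0_1); lra. Qed.

Ltac nonzero := repeat first
  [ assumption | solve [discrR] | apply Rmult_integral_contrapositive_currified ].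

Section AtPoint.
Variable z : R.
Hypothesis Hz : -1 < z < 1.

Lemma absQ : Rabs (Q z) < 1.
Proof. assert (HQ := Q_bounds z Hz); rewrite Rabs_pos_eq; lra. Qed.

Lemma Th_ge_1 : 1 <= Th z.
Proof. apply th_ge_1; assert (HQ := Q_bounds z Hz); lra. Qed.

Lemma A_eq : A z = Th z ^ 2.
Proof. unfold A; rewrite ev_a by apply absQ; unfold Th, th; ring. Qed.

Lemma A_pos : 0 < A z.
Proof. rewrite A_eq; assert (h := Th_ge_1); nra. Qed.

Lemma A1_eq : A1 z = 2 * Th z * Th1 z.
Proof. unfold A1; rewrite ev_D_a by apply absQ; simpl INR; unfold Th, th, Th1; ring. Qed.

(** The factor by which d/dz differs from the derivation of the terms. *)
Lemma G4 : c * G z ^ 4 = - PI * A z ^ 2 / (1 - z) ^ 2.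
Proof.
  assert (h0 := th0_ge_1).
  assert (hs : sqrt (1 - z) ^ 2 = 1 - z) by (apply pow2_sqrt; lra).
  assert (hp : 0 < sqrt (1 - z)) by (apply sqrt_lt_R0; lra).
  rewrite A_eq; unfold c, G.
  transitivity (- PI * Th z ^ 4 / (sqrt (1 - z) ^ 2) ^ 2); [field; lra|].
  rewrite hs; field; lra.
Qed.

Lemma is_derive_kap :
  is_derive kap z (2 * (c * G z ^ 4) * (kap z * (1 - 16 * kap z))).
Proof.
  assert (hA := A_pos); assert (hA0 := Rgt_not_eq (A z) 0 hA).
  assert (dA : is_derive A z (- 2 * PI / (1 - z) ^ 2 * A1 z))
    by (apply is_derive_ev_Q; [apply conv_a | assumption]).
  assert (dB : is_derive B z (- 2 * PI / (1 - z) ^ 2 * B1 z))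
    by (apply is_derive_ev_Q; [apply conv_b | assumption]).
  assert (w := ev_wronskian absQ); simpl INR in w.
  fold (A z) (B z) (A1 z) (B1 z) in w.
  unfold kap; auto_derive.
  - repeat split; try (eexists; eassumption); nonzero.
  - replace (Derive (fun x => A x) z) with (- 2 * PI / (1 - z) ^ 2 * A1 z)
      by (symmetry; apply is_derive_unique; exact dA).
    replace (Derive (fun x => B x) z) with (- 2 * PI / (1 - z) ^ 2 * B1 z)
      by (symmetry; apply is_derive_unique; exact dB).
    rewrite G4; set (a := A z) in *; set (b := B z) in *.
    set (a1 := A1 z) in *; set (b1 := B1 z) in *.
    assert (e : a * b1 = b * a1 - a * b * (a * a - b * b) / 2) by lra.
    assert (e1 : b1 = (b * a1 - a * b * (a * a - b * b) / 2) / a)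
      by (rewrite <- e; field; lra).
    rewrite e1; field; lra.
Qed.

Lemma is_derive_ell :
  is_derive ell z (2 * (c * G z ^ 4) * (4 * (kap z * (1 - 16 * kap z)) - ell z ^ 2)).
Proof.
  assert (hA := A_pos); assert (hpi := PI_RGT_0);
  assert (hA0 := Rgt_not_eq (A z) 0 hA); assert (hpi0 := Rgt_not_eq _ _ hpi).
  assert (dA : is_derive A z (- 2 * PI / (1 - z) ^ 2 * A1 z))
    by (apply is_derive_ev_Q; [apply conv_a | assumption]).
  assert (dA1 : is_derive A1 z (- 2 * PI / (1 - z) ^ 2 * A2 z))
    by (apply is_derive_ev_Q; [apply conv_fD, conv_a | assumption]).
  assert (w := ev_second_order absQ); simpl INR in w.
  fold (A z) (B z) (A1 z) (A2 z) in w.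
  unfold ell; auto_derive.
  - repeat split; try (eexists; eassumption); nonzero.
  - replace (Derive (fun x => A x) z) with (- 2 * PI / (1 - z) ^ 2 * A1 z)
      by (symmetry; apply is_derive_unique; exact dA).
    replace (Derive (fun x => A1 x) z) with (- 2 * PI / (1 - z) ^ 2 * A2 z)
      by (symmetry; apply is_derive_unique; exact dA1).
    rewrite G4; unfold kap; set (a := A z) in *; set (b := B z) in *.
    set (a1 := A1 z) in *; set (a2 := A2 z) in *.
    assert (e : a * a2 = 2 * (a1 * a1) + a * a * (b * b) * (a * a - b * b) / 4) by lra.
    assert (e1 : a2 = (2 * (a1 * a1) + a * a * (b * b) * (a * a - b * b) / 4) / a)
      by (rewrite <- e; field; lra).
    rewrite e1; field; lra.
Qed.

Lemma is_derive_G : is_derive G z (c * G z ^ 4 * (ell z * G z)).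
Proof.
  assert (hA := A_pos); assert (hpi := PI_RGT_0);
  assert (hA0 := Rgt_not_eq (A z) 0 hA); assert (hpi0 := Rgt_not_eq _ _ hpi); assert (h0 := th0_ge_1).
  assert (hT := Th_ge_1).
  assert (dT : is_derive Th z (- 2 * PI / (1 - z) ^ 2 * Th1 z))
    by (apply (is_derive_ev_Q ThetaSeries.theta); [apply conv_theta | assumption]).
  assert (hs : sqrt (1 - z) * sqrt (1 - z) = 1 - z) by (apply sqrt_sqrt; lra).
  assert (hp : 0 < sqrt (1 - z)) by (apply sqrt_lt_R0; lra).
  unfold G; auto_derive.
  - assert (h00 : th0 <> 0) by (apply Rgt_not_eq; lra).
    assert (hp0 := Rgt_not_eq (sqrt (1 - z)) 0 hp).
    repeat split; try (eexists; eassumption); try lra.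
    change (1 + - z) with (1 - z); nonzero.
  - replace (Derive (fun x => Th x) z) with (- 2 * PI / (1 - z) ^ 2 * Th1 z)
      by (symmetry; apply is_derive_unique; exact dT).
    fold (G z); rewrite G4; unfold ell, G; rewrite A1_eq, A_eq.
    replace (1 + - z) with (1 - z) by ring.
    set (s := sqrt (1 - z)) in *; rewrite <- hs; clearbody s.
    field; repeat split; apply Rgt_not_eq; lra.
Qed.

End AtPoint.

Lemma is_derive_evR (t : tm) (z : R) : -1 < z < 1 ->
  is_derive (fun z => evR (kap z) (ell z) t) z (c * G z ^ 4 * evR (kap z) (ell z) (dt t)).
Proof.
  intros Hz; assert (dk := is_derive_kap z Hz); assert (dl := is_derive_ell z Hz).
  induction t as [| | x | s IHs t IHt | s IHs t IHt].
  - unfold evR; simpl; evar_last; [exact dk | ring].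
  - unfold evR; simpl; evar_last; [exact dl | ring].
  - unfold evR; simpl; evar_last; [apply is_derive_const | unfold zero; simpl; ring].
  - evar_last; [exact (is_derive_plus _ _ _ _ _ IHs IHt)|].
    unfold evR, plus; simpl; ring.
  - evar_last; [exact (is_derive_mult _ _ _ _ _ IHs IHt Rmult_comm)|].
    unfold evR, plus, mult; simpl; ring.
Qed.

Lemma is_derive_step (n : nat) (z : R) : -1 < z < 1 ->
  is_derive (fun z => c ^ n * G z ^ (4 * n + 1) * evR (kap z) (ell z) (P n)) z
    (c ^ S n * G z ^ (4 * S n + 1) * evR (kap z) (ell z) (P (S n))).
Proof.
  intros Hz; assert (dG := is_derive_G z Hz).
  assert (dP := is_derive_evR (P n) z Hz).
  evar_last.
  - apply (is_derive_mult (fun z => c ^ n * G z ^ (4 * n + 1))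
      (fun z => evR (kap z) (ell z) (P n))); [| exact dP | intros; apply Rmult_comm].
    apply (is_derive_scal (fun z => G z ^ (4 * n + 1))).
    apply (is_derive_pow G _ z _ dG).
  - replace (4 * S n + 1)%nat with (4 + (4 * n + 1))%nat by lia.
    rewrite pow_add.
    replace (evR (kap z) (ell z) (P (S n))) with
      (evR (kap z) (ell z) (dt (P n)) + INR (4 * n + 1) * ell z * evR (kap z) (ell z) (P n)).
    + replace (pred (4 * n + 1)) with (4 * n)%nat by lia.
      rewrite Nat.add_1_r; change (G z ^ S (4 * n)) with (G z * G z ^ (4 * n)).
      unfold plus, mult, scal; simpl (c ^ S n); cbn; unfold mult; cbn; ring.
    + unfold evR; cbn [P Terms.ev]; f_equal.
      rewrite INR_IZR_INZ, Nat2Z.inj_add, Nat2Z.inj_mul; reflexivity.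
Qed.

Lemma Derive_n_G (n : nat) (z : R) : -1 < z < 1 ->
  Derive_n G n z = c ^ n * G z ^ (4 * n + 1) * evR (kap z) (ell z) (P n).
Proof.
  revert z; induction n as [|n IH]; intros z Hz.
  - unfold evR; simpl; ring.
  - simpl Derive_n; rewrite (Derive_ext_loc _
      (fun z => c ^ n * G z ^ (4 * n + 1) * evR (kap z) (ell z) (P n))).
    + now apply is_derive_unique, is_derive_step.
    + assert (He : 0 < Rmin (1 - z) (1 + z)) by (apply Rmin_pos; lra).
      exists (mkposreal _ He); intros x Hx; apply IH.
      change (Rabs (x - z) < Rmin (1 - z) (1 + z)) in Hx.
      assert (h1 := Rmin_l (1 - z) (1 + z)); assert (h2 := Rmin_r (1 - z) (1 + z)).
      apply Rabs_lt_between in Hx; lra.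
Qed.

Lemma G_0 : G 0 = 1.
Proof.
  unfold G, Th, Q, ordinate; rewrite Rminus_0_r, Rplus_0_r, sqrt_1.
  replace (1 / 1) with 1 by field; fold th0; assert (h := th0_ge_1); field; lra.
Qed.

End Flow.

(** * Numerical estimates *)

Module Numerics.
Import Coquelicot.Coquelicot.
Import RealCoefficients RealPowerSeries RealTheta ThetaOnAxis Flow.
Local Open Scope R_scope.
Local Set Bullet Behavior "Strict Subproofs".

Lemma PI_bounds : 3.14 < PI < 3.142.
Proof.
  assert (h := Machin.PI_2_3_7_ineq 2); revert h.
  unfold tg_alt, Machin.PI_2_3_7_tg, Ratan_seq; simpl; lra.
Qed.

Lemma nome_1_bounds : 0 < nome 1 <= / 22.
Proof.
  assert (hq := nome_bounds 1 Rlt_0_1); split; [lra|].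
  assert (h : 22 <= exp PI).
  { apply Rle_trans with (exp (0.785 + 0.785 + 0.785 + 0.785)).
    - assert (h := exp_ge_taylor 0.785 4 ltac:(lra)).
      rewrite !exp_plus; simpl in h.
      assert (h2 : 2.18 <= exp 0.785) by lra.
      set (x := exp 0.785) in *; assert (4.75 <= x * x) by nra; nra.
    - left; apply exp_increasing; assert (h := PI_bounds); lra. }
  unfold nome; rewrite Rmult_1_r, exp_Ropp; apply Rinv_le_contravar; lra.
Qed.

Lemma PSeries_bound (a : nat -> R) (q : R) : 0 <= q < 1 ->
  (forall n, Rabs (a n) <= 2) -> Rabs (PSeries a q) <= 2 / (1 - q).
Proof.
  intros Hq Ha.
  assert (E : ex_series (fun n => 2 * q ^ n)).
  { apply (ex_series_scal (K := R_AbsRing) (V := R_NormedModule) 2 (fun n => q ^ n)).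
    apply ex_series_geom; rewrite Rabs_pos_eq; lra. }
  assert (L : forall n, 0 <= Rabs (a n * q ^ n) <= 2 * q ^ n).
  { intros n; split; [apply Rabs_pos|].
    assert (hp : 0 <= q ^ n) by (apply pow_le; lra).
    rewrite Rabs_mult, (Rabs_pos_eq (q ^ n)) by assumption.
    apply Rmult_le_compat_r; auto. }
  unfold PSeries; eapply Rle_trans; [apply Series_Rabs|].
  - apply (ex_series_le (V := R_CompleteNormedModule) _ (fun n => 2 * q ^ n)); [|assumption].
    intros n; unfold norm; simpl; unfold abs; simpl; rewrite Rabs_Rabsolu; apply L.
  - eapply Rle_trans; [apply (Series_le _ _ L E)|].
    rewrite Series_scal_l, Series_geom by (rewrite Rabs_pos_eq; lra).
    unfold Rdiv; lra.
Qed.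

Lemma PSeries_two_terms (a : nat -> R) (q : R) : 0 <= q < 1 ->
  (forall n, Rabs (a n) <= 2) ->
  Rabs (PSeries a q - (a 0%nat + a 1%nat * q)) <= q ^ 2 * (2 / (1 - q)).
Proof.
  intros Hq Ha.
  assert (ex : forall b, (forall n, Rabs (b n) <= 2) -> ex_pseries b q).
  { intros b Hb; apply CV_radius_inside, (conv_bounded b 2 Hb).
    rewrite Rabs_pos_eq; lra. }
  rewrite (PSeries_decr_1 a q) by auto.
  rewrite (PSeries_decr_1 (PS_decr_1 a) q) by (apply ex; intros; apply Ha).
  set (r := PSeries (PS_decr_1 (PS_decr_1 a)) q).
  unfold PS_decr_1 at 1.
  replace (_ - _) with (q ^ 2 * r) by ring.
  rewrite Rabs_mult, (Rabs_pos_eq (q ^ 2)) by nra.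
  apply Rmult_le_compat_l; [nra|].
  apply PSeries_bound; [assumption | intros; apply Ha].
Qed.

Lemma tail_bound : nome 1 ^ 2 * (2 / (1 - nome 1)) <= nome 1 / 10.
Proof.
  assert (hq := nome_1_bounds); set (q := nome 1) in *.
  apply (Rmult_le_reg_r (1 - q)); [lra|].
  replace (q ^ 2 * (2 / (1 - q)) * (1 - q)) with (2 * q ^ 2) by (field; lra).
  nra.
Qed.

(** The coefficients are bounded by 2, so theta3 = 1 + 2 q up to a geometric tail. *)
Lemma th0_bounds : 1 < th0 <= 1.096.
Proof.
  assert (hq := nome_1_bounds); assert (ht := tail_bound).
  assert (h := PSeries_two_terms (rc ThetaSeries.theta) (nome 1) ltac:(lra) rc_theta_bound).
  rewrite rc_theta_0 in h; rewrite (rc_theta_sqr 0 : rc ThetaSeries.theta 1 = 2) in h.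
  fold (ev ThetaSeries.theta (nome 1)) in h; fold (th (nome 1)) in h; fold th0 in h.
  apply Rabs_le_between in h; lra.
Qed.

Lemma th4_bounds : 0 < th4 (nome 1) < 1.
Proof.
  assert (hq := nome_1_bounds); assert (ht := tail_bound).
  assert (hb : forall n, Rabs (rc ThetaSeries.theta4 n) <= 2).
  { intros n; rewrite rc_theta4, Rabs_mult, pow_1_abs, Rmult_1_l; apply rc_theta_bound. }
  assert (h := PSeries_two_terms (rc ThetaSeries.theta4) (nome 1) ltac:(lra) hb).
  rewrite !rc_theta4, rc_theta_0 in h.
  rewrite (rc_theta_sqr 0 : rc ThetaSeries.theta 1 = 2) in h.
  fold (ev ThetaSeries.theta4 (nome 1)) in h; fold (th4 (nome 1)) in h.
  apply Rabs_le_between in h; simpl in h; lra.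
Qed.

Lemma monotone (f df : R -> R) (x y : R) : x <= y ->
  (forall t, x <= t <= y -> is_derive f t (df t)) ->
  (forall t, x <= t <= y -> 0 <= df t) -> f x <= f y.
Proof.
  intros Hxy Hf Hdf.
  destruct (MVT_gen f x y df) as [s [Hs e]].
  - intros t Ht; rewrite Rmin_left, Rmax_right in Ht by assumption; apply Hf; lra.
  - intros t Ht; rewrite Rmin_left, Rmax_right in Ht by assumption.
    apply continuity_pt_filterlim, (ex_derive_continuous f t).
    exists (df t); now apply Hf.
  - rewrite Rmin_left, Rmax_right in Hs by assumption.
    assert (h := Hdf s Hs); nra.
Qed.

(** The errors of successive Taylor polynomials of exp (- x) are antiderivatives of
    each other up to sign, so they alternate in sign. *)
Lemma exp_neg_lower (x : R) : 0 <= x ->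
  1 - x + x ^ 2 / 2 - x ^ 3 / 6 <= exp (- x).
Proof.
  assert (mono : forall (f df : R -> R), (forall t, is_derive f t (df t)) ->
    (forall t, 0 <= t -> 0 <= df t) -> f 0 = 0 -> forall t, 0 <= t -> 0 <= f t).
  { intros f df Hf Hdf f0 t Ht; rewrite <- f0.
    apply (monotone f df); auto; intros; apply Hdf; lra. }
  assert (h2 : forall t, 0 <= t -> 0 <= 1 - t + t ^ 2 / 2 - exp (- t)).
  { apply (mono (fun t => 1 - t + t ^ 2 / 2 - exp (- t)) (fun t => -1 + t + exp (- t))).
    - intros t; auto_derive; [trivial | field].
    - intros t _; assert (h := exp_ineq1_le (- t)); lra.
    - rewrite Ropp_0, exp_0; field. }
  intros Hx.
  enough (0 <= exp (- x) - (1 - x + x ^ 2 / 2 - x ^ 3 / 6)) by lra.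
  apply (mono (fun t => exp (- t) - (1 - t + t ^ 2 / 2 - t ^ 3 / 6))
    (fun t => 1 - t + t ^ 2 / 2 - exp (- t))); [| assumption | | assumption].
  - intros t; auto_derive; [trivial | field].
  - rewrite Ropp_0, exp_0; field.
Qed.

(** The substitution t = u^4 removes the singularity of Euler's integral for
    Gamma (1/4). *)
Definition Gm (u : R) : R := RInt (fun s => 4 * exp (- s ^ 4)) 0 u.

Lemma is_derive_Gm (u : R) : is_derive Gm u (4 * exp (- u ^ 4)).
Proof.
  assert (Hc : forall t, continuous (fun s => 4 * exp (- s ^ 4)) t).
  { intros t; apply (ex_derive_continuous (fun s => 4 * exp (- s ^ 4)) t).
    auto_derive; trivial. }
  apply (is_derive_RInt (fun s => 4 * exp (- s ^ 4)) Gm 0 u); [|apply Hc].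
  exists (mkposreal 1 Rlt_0_1); intros y _.
  apply (RInt_correct (V := R_CompleteNormedModule)), (ex_RInt_continuous (V := R_CompleteNormedModule)).
  intros; apply Hc.
Qed.

Lemma Gm_0 : Gm 0 = 0.
Proof. apply (RInt_point (V := R_CompleteNormedModule)). Qed.

Lemma Gm_le (x y : R) : x <= y -> Gm x <= Gm y.
Proof.
  intros H; apply (monotone Gm (fun u => 4 * exp (- u ^ 4))); [assumption| |].
  - intros; apply is_derive_Gm.
  - intros t _; assert (h := exp_pos (- t ^ 4)); lra.
Qed.

(** The integral of the Taylor polynomial of degree 3 in s^4. *)
Lemma Gm_1 : 3.37 <= Gm 1.
Proof.
  assert (h := monotone
    (fun u => Gm u - (4 * u - 4 * u ^ 5 / 5 + 4 * u ^ 9 / 18 - 4 * u ^ 13 / 78))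
    (fun u => 4 * (exp (- u ^ 4) - (1 - u ^ 4 + (u ^ 4) ^ 2 / 2 - (u ^ 4) ^ 3 / 6)))
    0 1 ltac:(lra)).
  cbv beta in h; rewrite Gm_0 in h.
  enough (0 - (4 * 0 - 4 * 0 ^ 5 / 5 + 4 * 0 ^ 9 / 18 - 4 * 0 ^ 13 / 78) <=
    Gm 1 - (4 * 1 - 4 * 1 ^ 5 / 5 + 4 * 1 ^ 9 / 18 - 4 * 1 ^ 13 / 78)) by lra.
  apply h.
  - intros t _; evar_last.
    + apply (is_derive_minus (K := R_AbsRing) (V := R_NormedModule) Gm);
        [apply is_derive_Gm | auto_derive; [trivial | reflexivity]].
    + unfold minus, plus, opp; simpl; field.
  - intros t _; assert (h4 : 0 <= t ^ 4) by (replace (t ^ 4) with ((t ^ 2) ^ 2) by ring; nra).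
    assert (e := exp_neg_lower _ h4); lra.
Qed.

(** Beyond 1, exp (- s^4) is at most exp (- s). *)
Lemma Gm_bounded (x : R) : Gm x <= Gm 1 + 4.
Proof.
  destruct (Rle_dec x 1) as [H | H]; [assert (h := Gm_le x 1 H); lra|].
  assert (h := monotone (fun u => - 4 * exp (- u) - Gm u)
    (fun u => 4 * (exp (- u) - exp (- u ^ 4))) 1 x ltac:(lra)).
  cbv beta in h.
  enough (- 4 * exp (- (1)) - Gm 1 <= - 4 * exp (- x) - Gm x).
  { assert (h1 := exp_pos (- x)).
    assert (h2 : exp (- (1)) < exp 0) by (apply exp_increasing; lra).
    rewrite exp_0 in h2.
    lra. }
  apply h.
  - intros t _; evar_last.
    + apply (is_derive_minus (K := R_AbsRing) (V := R_NormedModule) _ Gm);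
        [auto_derive; [trivial | reflexivity] | apply is_derive_Gm].
    + unfold minus, plus, opp; simpl; ring.
  - intros t Ht; assert (ht : t <= t ^ 4) by (assert (1 <= t * t) by nra; nra).
    assert (exp (- t ^ 4) <= exp (- t)); [|lra].
    destruct (Req_dec t (t ^ 4)) as [e | ne]; [rewrite <- e; lra|].
    left; apply exp_increasing; lra.
Qed.

Lemma Gm_limit : exists l, 3.37 <= l /\ is_lim Gm p_infty l.
Proof.
  destruct (completeness (fun y => exists x, y = Gm x)) as [l [Hub Hl]].
  - exists (Gm 1 + 4); intros y [x ->]; apply Gm_bounded.
  - exists (Gm 1); now exists 1.
  - exists l; split.
    + apply Rle_trans with (1 := Gm_1), Hub; now exists 1.
    + apply is_lim_spec; intros eps.
      destruct (Classical_Prop.classic (exists x, l - eps < Gm x)) as [[x Hx] | Hn].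
      * exists x; intros y Hy; assert (h := Gm_le x y ltac:(lra)).
        assert (h' : Gm y <= l) by (apply Hub; now exists y).
        apply Rabs_def1; lra.
      * exfalso; assert (h : l <= l - eps).
        { apply Hl; intros y [x ->]; apply Rnot_lt_le; intros Hx; apply Hn; now exists x. }
        destruct eps as [eps He]; simpl in h; lra.
Qed.

Lemma Gamma_quarter : 3.37 <= Gamma (1 / 4).
Proof.
  destruct Gm_limit as [l [Hl Lim]].
  enough (e : Gamma (1 / 4) = l) by now rewrite e.
  unfold Gamma; apply is_RInt_gen_unique.
  set (f := fun t => Rpower t (1 / 4 - 1) * exp (- t)).
  set (F := fun t => Gm (Rpower t (1 / 4))).
  assert (dF : forall t, 0 < t -> is_derive F t (f t)).
  { intros t Ht; unfold F, f; evar_last.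
    - apply (is_derive_comp Gm (fun t => Rpower t (1 / 4))); [apply is_derive_Gm|].
      apply is_derive_Reals, derivable_pt_lim_power, Ht.
    - unfold scal; simpl; unfold mult; simpl.
      replace (Rpower t (1 / 4) * (Rpower t (1 / 4) * (Rpower t (1 / 4) * (Rpower t (1 / 4) * 1)))) with t.
      + field.
      + rewrite Rmult_1_r, <- !Rpower_plus.
        replace (1 / 4 + (1 / 4 + (1 / 4 + 1 / 4))) with 1 by field.
        now rewrite Rpower_1. }
  assert (pos : filter_prod (at_right 0) (Rbar_locally p_infty) (fun ab =>
      forall x, Rmin (fst ab) (snd ab) <= x <= Rmax (fst ab) (snd ab) -> 0 < x)).
  { apply (Filter_prod _ _ _ (fun x => 0 < x) (fun x => 0 < x)).
    - exists (mkposreal 1 Rlt_0_1); intros y _ Hy; exact Hy.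
    - exists 0; intros y Hy; exact Hy.
    - intros a b Ha Hb x [Hx _]; simpl in Hx.
      apply Rlt_le_trans with (2 := Hx); now apply Rmin_glb_lt. }
  apply (is_RInt_gen_ext (Derive F)).
  - revert pos; apply filter_imp; intros ab H x Hx.
    apply is_derive_unique, dF, H; lra.
  - replace l with (l - 0) by ring; apply is_RInt_gen_Derive.
    + revert pos; apply filter_imp; intros ab H x Hx.
      exists (f x); apply dF, H, Hx.
    + revert pos; apply filter_imp; intros ab H x Hx.
      specialize (H x Hx).
      apply (continuous_ext_loc (Derive F) f x).
      * exists (mkposreal x H); intros y Hy.
        change (Rabs (y - x) < x) in Hy; apply Rabs_lt_between in Hy.
        symmetry; apply is_derive_unique, dF; lra.
      * apply (ex_derive_continuous f); unfold f, Rpower; auto_derive; assumption.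
    + replace 0 with (Gm 0) at 2 by apply Gm_0.
      apply (filterlim_comp _ _ _ (fun t => Rpower t (1 / 4)) Gm _ (locally 0)).
      * intros P [eps HP].
        exists (mkposreal (Rpower eps 4) (exp_pos _)); intros y Hy Hy0; apply HP.
        change (Rabs (y - 0) < Rpower eps 4) in Hy.
        change (Rabs (Rpower y (1 / 4) - 0) < eps).
        rewrite Rminus_0_r, Rabs_pos_eq in * by (try (left; apply exp_pos); lra).
        rewrite <- (Rpower_1 eps) by apply cond_pos.
        replace 1 with (4 * (1 / 4)) at 2 by field.
        rewrite <- Rpower_mult; apply Rlt_Rpower_l; [lra|]; split; assumption.
      * apply (ex_derive_continuous Gm 0); eexists; apply is_derive_Gm.
    + apply (filterlim_comp _ _ _ (fun t => Rpower t (1 / 4)) Gm _ (Rbar_locally p_infty)); [|exact Lim].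
      intros P [M HP].
      exists (Rpower (Rabs M + 1) 4); intros y Hy; apply HP.
      assert (hM := Rle_abs M); assert (hM' := Rabs_pos M).
      apply Rlt_trans with (Rabs M + 1); [lra|].
      rewrite <- (Rpower_1 (Rabs M + 1)) by lra.
      replace 1 with (4 * (1 / 4)) at 2 by field.
      rewrite <- Rpower_mult; apply Rlt_Rpower_l; [lra|]; split; [apply exp_pos | assumption].
Qed.

(** Equivalently theta3(i)^8 < Gamma(1/4)^8 / (8 pi^6). The true value of the
    ratio is half of this bound, so crude estimates suffice. *)
Lemma normalisation : c ^ 2 < 16 * Phi.
Proof.
  assert (g := Gamma_quarter); assert (p := PI_bounds); assert (t := th0_bounds).
  unfold c, Phi; set (x := Gamma (1 / 4)) in *.
  assert (hx : 16600 <= x ^ 8).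
  { apply Rle_trans with (3.37 ^ 8); [lra | apply pow_incr; lra]. }
  assert (ht : th0 ^ 8 <= 2.0821).
  { apply Rle_trans with (1.096 ^ 8); [apply pow_incr; lra | lra]. }
  assert (hp : PI ^ 6 <= 963).
  { apply Rle_trans with (3.142 ^ 6); [apply pow_incr; lra | lra]. }
  assert (hp4 : 0 < PI ^ 4) by (apply pow_lt; lra).
  apply (Rmult_lt_reg_r (PI ^ 4)); [assumption|].
  replace ((- PI * th0 ^ 4) ^ 2 * PI ^ 4) with (PI ^ 6 * th0 ^ 8) by ring.
  replace (16 * (x ^ 8 / (128 * PI ^ 4)) * PI ^ 4) with (x ^ 8 / 8) by (field; lra).
  assert (h0 : 0 <= th0 ^ 8) by (apply pow_le; lra).
  assert (h1 : 0 <= PI ^ 6) by (apply pow_le; lra).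
  nra.
Qed.

End Numerics.

(** * The Taylor coefficients and the theorem *)

Module TaylorCoefficients.
Import Coquelicot.Coquelicot.
Import Terms Center RealPowerSeries RealTheta ThetaOnAxis Flow Numerics.
Local Open Scope R_scope.
Local Set Bullet Behavior "Strict Subproofs".

(** The expansion as a power series in z, with its vanishing odd coefficients. *)
Definition coefs (d : nat -> Z) (k : nat) : R :=
  if Nat.even k then IZR (d (Nat.div2 k)) / INR (fact k) * Phi ^ Nat.div2 k else 0.

Lemma coefs_even d n : coefs d (2 * n) = IZR (d n) / INR (fact (2 * n)) * Phi ^ n.
Proof.
  unfold coefs; rewrite Nat.even_mul, Nat.div2_double; reflexivity.
Qed.

Lemma coefs_odd d n : coefs d (2 * n + 1) = 0.
Proof.
  unfold coefs; rewrite Nat.even_add, Nat.even_mul; reflexivity.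
Qed.

Lemma is_series_Re (u : nat -> C) (s : C) :
  is_series (K := C_AbsRing) (V := C_NormedModule) u s ->
  is_series (K := R_AbsRing) (V := R_NormedModule) (fun n => fst (u n)) (fst s).
Proof.
  intros H.
  assert (e : forall N, sum_n (fun n => fst (u n)) N = fst (sum_n (G := C_AbelianMonoid) u N)).
  { induction N as [|N IH]; [now rewrite !sum_O|].
    rewrite !sum_Sn, IH; reflexivity. }
  apply (filterlim_ext (fun N => fst (sum_n (G := C_AbelianMonoid) u N))); [intros; now rewrite e|].
  apply (filterlim_comp _ _ _ _ fst _ _ _ H).
  intros P [eps HP]; exists eps; intros y [Hy _]; apply HP, Hy.
Qed.

Lemma is_series_Im (u : nat -> C) (s : C) :
  is_series (K := C_AbsRing) (V := C_NormedModule) u s ->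
  (forall n, snd (u n) = 0) -> snd s = 0.
Proof.
  intros H Hu.
  assert (e : forall N, snd (sum_n (G := C_AbelianMonoid) u N) = 0).
  { induction N as [|N IH]; [now rewrite sum_O|].
    rewrite sum_Sn; change (snd (sum_n (G := C_AbelianMonoid) u N) + snd (u (S N)) = 0).
    rewrite IH, Hu; ring. }
  assert (L : is_lim_seq (fun _ => 0) (snd s)).
  { apply (is_lim_seq_ext (fun N => snd (sum_n (G := C_AbelianMonoid) u N)) _ _ e).
    apply (filterlim_comp _ _ _ _ snd _ _ _ H).
    intros P [eps HP]; exists eps; intros y [_ Hy]; apply HP, Hy. }
  apply is_lim_seq_unique in L; rewrite Lim_seq_const in L; now injection L.
Qed.

Section Coefficients.
Variable d : nat -> Z.
Hypothesis hd : is_theta3_taylor d.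

(** For real z everything is real, so the complex expansion restricts to a real
    power series. *)
Lemma expansion_real : exists eps : posreal, forall x : R, Rabs x < eps ->
  is_pseries (coefs d) x (G x).
Proof.
  destruct hd as [eps H].
  assert (He : 0 < Rmin eps 1) by (apply Rmin_pos; [apply cond_pos | lra]).
  exists (mkposreal _ He); intros x Hx; simpl in Hx.
  assert (h1 := Rmin_l eps 1); assert (h2 := Rmin_r eps 1).
  assert (Hx1 : -1 < x < 1) by (apply Rabs_lt_between; lra).
  destruct (H (RtoC x)) as [s [Hs e]].
  { split; simpl.
    - change (Rabs (x - 0) < eps); rewrite Rminus_0_r; lra.
    - change (Rabs (0 - 0) < eps); rewrite Rminus_0_r, Rabs_R0; apply cond_pos. }
  assert (term : forall n, (RtoC (IZR (d n) / INR (fact (2 * n)) * Phi ^ n) * RtoC x ^ (2 * n))%C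
    = RtoC (coefs d (2 * n) * (x ^ 2) ^ n)).
  { intros n; rewrite Cpow_RtoC, coefs_even, <- pow_mult, <- RtoC_mult; reflexivity. }
  assert (Im_s : snd s = 0).
  { apply (is_series_Im _ _ Hs); intros n; now rewrite term. }
  assert (Re_s := is_series_Re _ _ Hs).
  assert (es : G x = fst s).
  { replace ((1 + RtoC x) / (1 - RtoC x))%C with (RtoC (ordinate x)) in e.
    - rewrite theta3_axis in e by (apply Rdiv_lt_0_compat; lra).
      replace (1 - RtoC x)%C with (RtoC (1 - x)) in e
        by (apply injective_projections; simpl; ring).
      rewrite Csqrt_RtoC in e by lra.
      replace Ci with (Ci * RtoC 1)%C in e by apply Cmult_1_r.
      rewrite theta3_axis in e by lra.
      apply (f_equal fst) in e; simpl in e; rewrite Im_s in e.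
      assert (h0 := th0_ge_1).
      assert (hp : 0 < sqrt (1 - x)) by (apply sqrt_lt_R0; lra).
      unfold G, Th, Q; rewrite e; fold th0; field; lra.
    - unfold ordinate; rewrite RtoC_div, RtoC_plus, RtoC_minus by lra; reflexivity. }
  rewrite es; replace (fst s) with (fst s + x * 0) by ring.
  apply is_pseries_odd_even.
  - apply is_pseries_R; eapply is_series_ext; [|exact Re_s].
    intros n; cbv beta; rewrite term; reflexivity.
  - apply is_pseries_R, (is_series_ext (fun _ => 0)).
    + intros n; rewrite coefs_odd; symmetry; apply Rmult_0_l.
    + apply is_series_0.
Qed.

(** Both sides are the n-th derivative of G at 0. *)
Lemma coefs_P (n : nat) :
  coefs d n * INR (fact n) = c ^ n * evR (kap 0) (ell 0) (P n).
Proof.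
  destruct expansion_real as [eps H].
  assert (conv0 : Rbar_lt 0 (CV_radius (coefs d))).
  { apply Rbar_not_le_lt; intros Hle.
    assert (Hx : Rabs (eps / 2) = eps / 2) by (apply Rabs_pos_eq; destruct eps; simpl; lra).
    apply (CV_disk_outside (coefs d) (eps / 2)).
    - apply Rbar_le_lt_trans with 0; [assumption|].
      rewrite Hx; destruct eps; simpl; lra.
    - apply ex_series_lim_0; exists (G (eps / 2)).
      apply is_pseries_R, H; rewrite Hx; destruct eps; simpl; lra. }
  rewrite <- Derive_n_coef by assumption.
  rewrite <- (Derive_n_ext_loc G).
  - rewrite Derive_n_G, G_0, pow1 by lra; ring.
  - exists eps; intros x Hx; symmetry; apply is_pseries_unique, H.
    change (Rabs (x - 0) < eps) in Hx; now rewrite Rminus_0_r in Hx.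
Qed.

Lemma c_neq_0 : c <> 0.
Proof.
  unfold c; assert (h := PI_bounds); assert (h0 := th0_bounds).
  assert (h4 : 0 < th0 ^ 4) by (apply pow_lt; lra); nra.
Qed.

Lemma odd_vanish (n : nat) : evR (kap 0) (ell 0) (P (2 * n + 1)) = 0.
Proof.
  assert (h := coefs_P (2 * n + 1)); rewrite coefs_odd, Rmult_0_l in h.
  symmetry in h; apply Rmult_integral in h; destruct h as [h|h]; [|exact h].
  now apply pow_nonzero in h; [|apply c_neq_0].
Qed.

(** P_1 is ell, and its value at z = 0 is the vanishing coefficient of z. *)
Lemma ell_0 : ell 0 = 0.
Proof. assert (h := odd_vanish 0); unfold evR in h; simpl in h; lra. Qed.

(** When ell = 0, P_3 is a multiple of kappa (1 - 16 kappa) (1 - 32 kappa). The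
    estimates of theta3(i) and theta4(i) exclude the first two factors. *)
Lemma kap_0 : kap 0 = 1 / 32.
Proof.
  assert (h := odd_vanish 1); rewrite ell_0 in h; unfold evR in h; simpl in h.
  assert (b : 0 < kap 0 < 1 / 16).
  { assert (Q0 : Q 0 = nome 1) by (unfold Q, ordinate; f_equal; field).
    assert (t := th0_bounds); assert (t4 := th4_bounds).
    assert (hz : -1 < 0 < 1) by lra.
    assert (eA : A 0 = th0 ^ 2) by (rewrite A_eq by lra; unfold Th; rewrite Q0; reflexivity).
    assert (eB : B 0 = th4 (nome 1) ^ 2).
    { unfold B; rewrite ev_b by (apply absQ; lra); rewrite Q0; unfold th4; ring. }
    assert (hA : 1 < A 0) by (rewrite eA; nra).
    assert (hB : 0 < B 0 < 1) by (rewrite eB; nra).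
    unfold kap; split.
    - apply Rdiv_lt_0_compat; nra.
    - apply (Rmult_lt_reg_r (16 * A 0 ^ 2)); [nra|].
      replace ((A 0 ^ 2 - B 0 ^ 2) / (16 * A 0 ^ 2) * (16 * A 0 ^ 2)) with (A 0 ^ 2 - B 0 ^ 2)
        by (field; lra).
      nra. }
  set (k := kap 0) in *.
  assert (h' : (k * (1 - 16 * k)) * (1 - 32 * k) = 0) by nra.
  apply Rmult_integral in h'; destruct h' as [h'|h']; [nra | lra].
Qed.

Lemma even_value (n : nat) : IZR (d n) * Phi ^ n = (c ^ 2) ^ n * evR (1 / 32) 0 (P (2 * n)).
Proof.
  assert (h := coefs_P (2 * n)); rewrite coefs_even, kap_0, ell_0, pow_mult in h.
  rewrite <- h; field; apply INR_fact_neq_0.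
Qed.

(** The expansion gives d(1) = c^2 / (8 Phi). As an integer strictly between 0 and
    2 this is 1, which yields the classical relation between theta3(i) and
    Gamma(1/4). *)
Lemma Phi_value : c ^ 2 = 8 * Phi.
Proof.
  assert (h := even_value 1); unfold evR in h; simpl in h.
  assert (n := normalisation).
  assert (c2 : 0 < c ^ 2) by (assert (h0 := c_neq_0); nra).
  assert (e : IZR (d 1) * Phi = c ^ 2 / 8) by (simpl; lra).
  assert (b1 : 0 < IZR (d 1)) by nra.
  assert (b2 : IZR (d 1) < 2) by nra.
  assert (d1 : d 1%nat = 1%Z).
  { apply lt_IZR in b1; apply lt_IZR in b2; lia. }
  rewrite d1 in e; lra.
Qed.

Theorem taylor_coefficient (n : nat) :
  IZR (d n) = 8 ^ n * evR (1 / 32) 0 (P (2 * n)).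
Proof.
  assert (h := even_value n).
  assert (hp : Phi ^ n <> 0).
  { apply pow_nonzero; assert (e := Phi_value); assert (h0 := c_neq_0).
    intros e0; rewrite e0 in e; nra. }
  rewrite Phi_value, Rpow_mult_distr in h.
  apply (Rmult_eq_reg_r (Phi ^ n)); [|exact hp].
  rewrite h; ring.
Qed.

End Coefficients.
End TaylorCoefficients.

Theorem mainTheorem2 (d : nat -> Z) (hd : is_theta3_taylor d)
    (p : nat) (hp : prime (Z.of_nat p)) (hp4 : (p mod 4 = 1)%nat)
    (e : nat) (he : (1 <= e)%nat) (n : nat) (hn : (e + 1 <= n)%nat) :
  (d (n + p ^ (e - 1) * (p - 1) / 2)%nat mod Z.of_nat p ^ Z.of_nat e
   = ((-1) ^ Z.of_nat ((p - 5) / 4)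
      * prod_4j_sub_1 ((p - 1) / 2) ^ Z.of_nat (2 * p ^ (e - 1))
      * d n) mod Z.of_nat p ^ Z.of_nat e)%Z.
Proof.
  assert (p_ge2 := prime_ge_2 _ hp).
  assert (exists r, (p = 4 * r + 1 /\ 1 <= r)%nat) as [r [pr r1]].
  { exists (p / 4)%nat; assert (h := Nat.div_mod_eq p 4); lia. }
  assert (h := @Bridge.real_periodicity d p r e n hp pr he ltac:(lia)
    (TaylorCoefficients.taylor_coefficient d hd)).
  replace ((p - 1) / 2)%nat with (2 * r)%nat
    by (replace (p - 1)%nat with (2 * r * 2)%nat by lia; now rewrite Nat.div_mul).
  replace ((p - 5) / 4)%nat with (r - 1)%nat
    by (replace (p - 5)%nat with ((r - 1) * 4)%nat by lia; now rewrite Nat.div_mul).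
  replace (p ^ (e - 1) * (p - 1) / 2)%nat with (p ^ (e - 1) * (2 * r))%nat
    by (replace (p ^ (e - 1) * (p - 1))%nat with (p ^ (e - 1) * (2 * r) * 2)%nat by nia;
        now rewrite Nat.div_mul).
  assert (sign : ((-1) ^ Z.of_nat (S r) = (-1) ^ Z.of_nat (r - 1))%Z).
  { replace (Z.of_nat (S r)) with (Z.of_nat (r - 1) + 2)%Z by lia.
    rewrite Z.pow_add_r by lia; change ((-1) ^ 2)%Z with 1%Z; ring. }
  rewrite sign in h; rewrite Nat2Z.inj_pow in h.
  destruct h as [q h].
  rewrite <- (Z_mod_plus_full (_ * d n) q), <- h; f_equal; ring.
Qed.
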